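(* Let $S_1,S_2,\ldots\sim_{i.i.d.} f_s$ be locations in $\mathcal R$. Let $(g(\cdot),h(\cdot))$ be a $(p+1)$-dimensional random function (stochastic process) on $\mathcal R$, with $g$ real-valued and $h=(h_1,\ldots,h_p)^\top$ being $\mathbb R^p$-valued, having almost surely continuous sample paths and independent of $\epsilon(\cdot)$, $\eta(\cdot)$ and $S_1,S_2,\ldots$. For $i=1,\ldots,n$ let $X(S_i)=h(S_i)+\eta(S_i)\in\mathbb R^p$ and $Y(S_i)=X(S_i)^\top\beta^*+g(S_i)+\epsilon(S_i)$ with $\beta^*\in\mathbb R^p$. Let $$\hat\beta_{GLS}=(X^\top\Sigma^{-1}X)^{-1}X^\top\Sigma^{-1}Y,$$ where $\Sigma=K+\tau^2 I$, $0<\tau^2<\infty$, $K_{ij}=K(S_i,S_j)$, and $K(\cdot,\cdot)$ is a stationary Matérn kernel with any fixed set of parameters (variance $0<\sigma^2<\infty$, spatial decay $0<\phi<\infty$, smoothness $0<\nu\le\infty$, where $\nu=\infty$ denotes the squared exponential kernel). Then $\hat\beta_{GLS}\to\beta^*$ in probability as $n\to\infty$.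
   Context: $\mathcal R\subset\mathbb R^d$ is a fixed convex and compact spatial domain, and $f_s$ is a probability density (with respect to Lebesgue measure) with support the whole of $\mathcal R$. $X$ is the $n\times p$ matrix with rows $X(S_1)^\top,\ldots,X(S_n)^\top$ and $Y=(Y(S_1),\ldots,Y(S_n))^\top$; $p$ and $\mathcal R$ are fixed as $n\to\infty$. No restriction is placed on the dependence between $g(\cdot)$ and $h(\cdot)$. Error assumptions: $\{\epsilon(s)\}_{s\in\mathcal R}$ are i.i.d. real random variables with $E(\epsilon(s))=0$, $\mathrm{var}(\epsilon(s))<\infty$; $\{\eta(s)\}_{s\in\mathcal R}$ are i.i.d. $\mathbb R^p$-valued random vectors with $E(\eta(s))=0$ and $\mathrm{var}(\eta(s))$ finite and strictly positive definite; the process $\epsilon(\cdot)$, the process $\eta(\cdot)$ and the locations $S_1,S_2,\ldots$ are mutually independent, and $(g(\cdot),h(\cdot))$ is independent of all of them jointly. Since locations are almost surely distinct, this is understood to mean that $\epsilon(S_1),\epsilon(S_2),\ldots$ are i.i.d. with the law of $\epsilon(s)$, $\eta(S_1),\eta(S_2),\ldots$ are i.i.d. with the law of $\eta(s)$, and these two sequences, the sequence of locations, and $(g(\cdot),h(\cdot))$ are mutually independent. Matérn kernel: for $0<\nu<\infty$, $K(s,s')=\sigma^2\frac{2^{1-\nu}}{\Gamma(\nu)}(\phi\|s-s'\|)^\nu \mathcal K_\nu(\phi\|s-s'\|)$ for $s\ne s'$ and $K(s,s)=\sigma^2$, where $\mathcal K_\nu$ is the modified Bessel function of the second kind; for $\nu=\infty$,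 $K(s,s')=\sigma^2\exp(-\phi\|s-s'\|^2)$. On the event that $X^\top\Sigma^{-1}X$ is singular, $\hat\beta_{GLS}$ may be assigned an arbitrary value. *)

(* Defs.v *)
From HB Require Import structures.
From mathcomp Require Import all_boot all_order all_algebra.
From mathcomp Require Import all_classical all_reals all_analysis.

Set Implicit Arguments.
Unset Strict Implicit.
Unset Printing Implicit Defensive.

Import Order.TTheory GRing.Theory Num.Theory.
Import numFieldNormedType.Exports.

Local Open Scope classical_set_scope.
Local Open Scope ring_scope.

Definition measure_matrix_display : measure_display -> measure_display.
Proof. exact. Qed.

(* Matrices carry the product sigma-algebra, generated by the entries. *)
Section measurable_matrix.
Context {d} {T : measurableType d} (m n : nat).

Definition matrix_measurable : set (set 'M[T]_(m, n)) :=
  <<s \bigcup_(ij in [set: 'I_m * 'I_n])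
        preimage_set_system setT (fun A : 'M[T]_(m, n) => A ij.1 ij.2)
          measurable >>.

Let matrix_set0 : matrix_measurable set0.
Proof. exact: sigma_algebra0. Qed.

Let matrix_setC A : matrix_measurable A -> matrix_measurable (~` A).
Proof. exact: sigma_algebraC. Qed.

Let matrix_bigcup (F : _^nat) : (forall i, matrix_measurable (F i)) ->
  matrix_measurable (\bigcup_i (F i)).
Proof. exact: sigma_algebra_bigcup. Qed.

HB.instance Definition _ :=
  @isMeasurable.Build (measure_matrix_display d) 'M[T]_(m, n)
    matrix_measurable matrix_set0 matrix_setC matrix_bigcup.

End measurable_matrix.


Section measurable_matrix_theory.
Context d d' {T : measurableType d} {aT : measurableType d'} (m n : nat).

Lemma measurable_coord (i : 'I_m) (j : 'I_n) :
  measurable_fun [set: 'M[T]_(m, n)] (fun A : 'M[T]_(m, n) => A i j).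
Proof.
move=> _ Y mY; apply: sub_sigma_algebra.
by exists (i, j) => //; exists Y.
Qed.

Lemma measurable_fun_matrixP (f : aT -> 'M[T]_(m, n)) :
  measurable_fun [set: aT] f <->
  forall i j, measurable_fun [set: aT] (fun x => f x i j).
Proof.
split=> [mf i j|mf]; first exact: measurableT_comp (measurable_coord i j) mf.
have sub : @measurable _ 'M[T]_(m, n) `<=`
    image_set_system [set: aT] f measurable.
  apply: smallest_sub.
    by apply: sigma_algebra_image; exact: sigma_algebra_measurable.
  move=> _ [[i j] _ [Y mY <-]]; rewrite /image_set_system /= !setTI.
  by have := mf i j measurableT _ mY; rewrite setTI.
by move=> _ A mA; exact: sub.
Qed.

End measurable_matrix_theory.

(* Lebesgue measure on 'rV[R]_n: the image of the n-fold product measure,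
   built one coordinate at a time (row_mx x%:M v prepends x to v). *)
Section lebesgue_rV.
Context (R : realType).

Definition cons_rV n (xv : measurableTypeR R * 'rV[R]_n) : 'rV[R]_n.+1 :=
  row_mx ((xv.1 : R)%:M) xv.2 : 'rV[R]_(1 + n).

Definition uncons_rV n (w : 'rV[R]_n.+1) : measurableTypeR R * 'rV[R]_n :=
  (w 0 0, rsubmx (w : 'rV[R]_(1 + n))).

Lemma cons_rV0 n (xv : measurableTypeR R * 'rV[R]_n) i : cons_rV xv i ord0 = xv.1.
Proof.
have -> : (ord0 : 'I_n.+1) = lshift n (0 : 'I_1) by exact/val_inj.
by apply: etrans (row_mxEl _ _ _ _) _; rewrite mxE !ord1 eqxx mulr1n.
Qed.

Lemma cons_rVS n (xv : measurableTypeR R * 'rV[R]_n) i j :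
  cons_rV xv i (lift ord0 j) = xv.2 i j.
Proof.
have -> : lift ord0 j = rshift 1 j by exact/val_inj.
exact: row_mxEr.
Qed.

Lemma cons_rVK n : cancel (@cons_rV n) (@uncons_rV n).
Proof.
move=> [x v]; rewrite /uncons_rV; congr pair; first exact: cons_rV0.
exact: row_mxKr.
Qed.

Lemma measurable_cons_rV n :
  measurable_fun [set: measurableTypeR R * 'rV[R]_n] (@cons_rV n).
Proof.
apply/measurable_fun_matrixP => i j; case: (unliftP ord0 j) => [k|] ->.
  under eq_fun do rewrite cons_rVS.
  exact: measurableT_comp (measurable_coord i k) measurable_snd.
under eq_fun do rewrite cons_rV0.
exact: measurable_fst.
Qed.

Lemma measurable_uncons_rV n :
  measurable_fun [set: 'rV[R]_n.+1] (@uncons_rV n).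
Proof.
apply: measurable_fun_pair; first exact: measurable_coord.
apply/measurable_fun_matrixP => i j.
rewrite [X in measurable_fun _ X](_ : _ =
    (fun v : 'rV[R]_n.+1 => v i (rshift 1 j))); last first.
  by apply/funext => v; rewrite mxE.
exact: measurable_coord.
Qed.

Section step.
Variables (n : nat) (mu : {sigma_finite_measure set 'rV[R]_n -> \bar R}).

Definition lebesgue_rV_step : set 'rV[R]_n.+1 -> \bar R :=
  pushforward (@lebesgue_measure R \x mu)%E (@cons_rV n).

Let lebesgue_rV_step0 : lebesgue_rV_step set0 = 0%E.
Proof. by rewrite /lebesgue_rV_step /pushforward preimage_set0 measure0. Qed.

Let lebesgue_rV_step_ge0 A : (0 <= lebesgue_rV_step A)%E.
Proof. by rewrite /lebesgue_rV_step /pushforward measure_ge0. Qed.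

Let lebesgue_rV_step_sigma_additive : semi_sigma_additive lebesgue_rV_step.
Proof.
by apply: measure_semi_sigma_additive; exact: measurable_cons_rV.
Qed.

HB.instance Definition _ := isMeasure.Build _ _ _ lebesgue_rV_step
  lebesgue_rV_step0 lebesgue_rV_step_ge0 lebesgue_rV_step_sigma_additive.

Let lebesgue_rV_step_sigma_finite : sigma_finite setT lebesgue_rV_step.
Proof.
have /sigma_finiteP[F [TF ndF Foo]] := sigma_finiteT (@lebesgue_measure R).
have /sigma_finiteP[G [TG ndG Goo]] := sigma_finiteT mu.
exists (fun k => @uncons_rV n @^-1` (F k `*` G k)).
  apply/seteqP; split=> // w _.
  have [k _ Fk] : (\bigcup_k F k) (w 0 0) by rewrite -TF.
  have [l _ Gl] : (\bigcup_k G k) (uncons_rV w).2 by rewrite -TG.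
  exists (maxn k l) => //; split => /=.
    by move: Fk; exact/subsetPset/ndF/leq_maxl.
  by move: Gl; exact/subsetPset/ndG/leq_maxr.
move=> k; have [mFk Fk] := Foo k; have [mGk Gk] := Goo k; split.
  rewrite -[_ @^-1` _]setTI; apply: measurable_uncons_rV => //.
  exact: measurableX.
rewrite /lebesgue_rV_step /pushforward -comp_preimage.
rewrite (_ : _ \o _ = id); last by apply/funext => xv /=; rewrite cons_rVK.
by rewrite preimage_id product_measure1E// lte_mul_pinfty// ge0_fin_numE.
Qed.

HB.instance Definition _ := Measure_isSigmaFinite.Build _ _ _
  lebesgue_rV_step lebesgue_rV_step_sigma_finite.

End step.

Fixpoint lebesgue_rV n : {sigma_finite_measure set 'rV[R]_n -> \bar R} :=
  match n with
  | 0 => [the {sigma_finite_measure set 'rV[R]_0 -> \bar R} of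
           dirac (0 : 'rV[R]_0)]
  | n'.+1 => [the {sigma_finite_measure set 'rV[R]_n'.+1 -> \bar R} of
           lebesgue_rV_step (lebesgue_rV n')]
  end.

Lemma lebesgue_rV_box n (B : 'I_n -> set R) : (forall i, measurable (B i)) ->
  (lebesgue_rV n [set v : 'rV[R]_n | forall i, B i (v ord0 i)] =
   \prod_(i < n) lebesgue_measure (B i))%E.
Proof.
elim: n B => [|n IHn] B mB.
  rewrite big_ord0 /= diracE mem_set//= => -[]//.
rewrite big_ord_recl -(IHn (fun i => B (lift ord0 i)))//.
set C := (X in lebesgue_rV n X).
have mC : measurable C.
  rewrite (_ : C = \bigcap_(i in [set: 'I_n])
     ((fun v : 'rV[R]_n => v ord0 i) @^-1` B (lift ord0 i))); last first.
    by apply/seteqP; split=> v /= Bv i; [move=> _|]; exact: Bv.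
  apply: fin_bigcap_measurable => // i _.
  by rewrite -[_ @^-1` _]setTI; apply: measurable_coord.
apply: etrans
  (@product_measure1E _ _ _ _ _ lebesgue_measure (lebesgue_rV n) _ _
     (mB ord0) mC).
rewrite /= /lebesgue_rV_step /pushforward; f_equal.
apply/seteqP; split=> xv /=.
  move=> Bv; split; first by rewrite -(cons_rV0 xv ord0); exact: Bv.
  by move=> i /=; rewrite -cons_rVS; exact: Bv.
move=> [B0 BS] i; case: (unliftP ord0 i) => [j|] ->.
  by rewrite cons_rVS; exact: BS.
by rewrite cons_rV0.
Qed.

End lebesgue_rV.

(* Euclidean norm; the library norm on matrices is the max norm. *)
Definition enorm (R : rcfType) m n (A : 'M[R]_(m, n)) : R :=
  Num.sqrt (\sum_i \sum_j A i j ^+ 2).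

Definition posdef (R : numDomainType) n (A : 'M[R]_n) : Prop :=
  forall v : 'rV[R]_n, v != 0 -> 0 < (v *m A *m v^T) ord0 ord0.

Section matern.
Context {R : realType}.
Implicit Types nu x : R.

Definition cosh x : R := (expR x + expR (- x)) / 2.

Definition Gamma nu : R :=
  \int[lebesgue_measure]_(t in `]0, +oo[) (t `^ (nu - 1) * expR (- t)).

(* Modified Bessel function of the second kind, by its standard integral
   representation, valid for x > 0. *)
Definition besselK nu x : R :=
  \int[lebesgue_measure]_(t in `[0, +oo[)
    (expR (- (x * cosh t)) * cosh (nu * t)).

(* nu = -oo is a junk value. *)
Definition matern d (sigma2 phi : R) (nu : \bar R) (s s' : 'rV[R]_d) : R :=
  match nu with
  | v%:E =>
      if s == s' then sigma2 else
      let r := phi * enorm (s - s') in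
      sigma2 * (2 `^ (1 - v) / Gamma v) * r `^ v * besselK v r
  | +oo%E => sigma2 * expR (- (phi * enorm (s - s') ^+ 2))
  | -oo%E => 0
  end.

End matern.

Definition gls (R : realType) n p
    (Sigma : 'M[R]_n) (X : 'M[R]_(n, p)) (Y : 'cV[R]_n) : 'cV[R]_p :=
  invmx (X^T *m invmx Sigma *m X) *m X^T *m invmx Sigma *m Y.

Section density.
Context {R : realType} {d : nat}.
Implicit Type f : 'rV[R]_d -> R.

Definition is_density f : Prop :=
  [/\ measurable_fun [set: 'rV[R]_d] f,
      forall x, 0 <= f x &
      (\int[lebesgue_rV R d]_x (f x)%:E = 1)%E].

(* The support of the law with density f (insensitive to changes of f on a
   null set), not the closure of the set where f is nonzero. *)
Definition density_support f : set 'rV[R]_d :=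
  [set x | forall U : set 'rV[R]_d, open U -> U x ->
     (0 < \int[lebesgue_rV R d]_(y in U) (f y)%:E)%E].

End density.

Section random.
Context {R : realType} {dO : measure_display} {Omega : measurableType dO}.
Variable P : probability Omega R.
Local Open Scope ereal_scope.

Definition has_density n (X : {RV P >-> 'rV[R]_n}) (f : 'rV[R]_n -> R) : Prop :=
  forall A : set 'rV[R]_n, measurable A ->
    distribution P X A = \int[lebesgue_rV R n]_(x in A) (f x)%:E.

Definition sigma_process d' (T : measurableType d') (I : Type) (J : set I)
    (X : I -> Omega -> T) : set (set Omega) :=
  <<s \bigcup_(i in J) preimage_set_system setT (X i) measurable >>.

Definition mutual_independence (I : eqType) (F : I -> set (set Omega)) : Prop :=
  forall s : seq I, uniq s ->
  forall A : I -> set Omega, (forall i, i \in s -> F i (A i)) ->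
    P (\bigcap_(i in [set` s]) A i) = \prod_(i <- s) P (A i).

Definition iid d' (T : measurableType d') (X : nat -> {RV P >-> T}) : Prop :=
  mutual_independence (fun i => preimage_set_system setT (X i) measurable) /\
  forall i (A : set T), measurable A ->
    distribution P (X i) A = distribution P (X 0%N) A.

Definition covariance_mx n (X : Omega -> 'rV[R]_n) : 'M[R]_n :=
  (\matrix_(j, k) fine (covariance P (fun w => X w ord0 j)
                                     (fun w => X w ord0 k)))%R.

Definition cvg_in_probability m n (Z : nat -> {RV P >-> 'M[R]_(m, n)})
    (c : 'M[R]_(m, n)) : Prop :=
  forall e : R, (0 < e)%R ->
    P [set w | (e < enorm (Z k w - c))%R] @[k --> \oo] --> 0.

End random.

(* Main.v *)
Require Import Defs.
From HB Require Import structures.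
From mathcomp Require Import all_boot all_order all_algebra.
From mathcomp Require Import all_classical all_reals all_analysis.
From mathcomp Require Import measurable_realfun.
From mathcomp Require Import ring lra.

Set Implicit Arguments.
Unset Strict Implicit.
Unset Printing Implicit Defensive.

Import Order.TTheory GRing.Theory Num.Theory.
Import numFieldNormedType.Exports.

Local Open Scope classical_set_scope.
Local Open Scope ring_scope.

(** Write [P] for the inverse of [Sigma = K + tau2 I]. The estimation error [b]
    solves [X^T P X b = X^T P (g + eps)], so it is enough that, divided by [n],
    the [P]-forms of [g] and [h] vanish, those of [eta b] stay away from 0, and
    the cross terms between [eta] and [eps] vanish.

    - Smooth terms. With [v = P g] one has [g^T P g = 2 v^T g - v^T Sigma v]. The
      Matern kernel is a mixture of Gaussian kernels
      [exp (- phi^2 |s - s'|^2 / (4 t))] with weight [t^(nu-1) exp (- t)], whose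
      native spaces contain the polynomials times a Gaussian, and these are
      uniformly dense in the continuous functions on a compact set. Hence
      [g^T P g <= C + e n] for every [e > 0], surely in the locations.
    - Lower bound. By Cauchy-Schwarz
      [|eta b|^4 <= ((eta b)^T Sigma (eta b)) ((eta b)^T P (eta b))], where
      [|eta b|^2] is at least of order [n |b|^2] by the law of large numbers for
      truncated moments, and the [Sigma]-form is [O (n)] because its expectation
      only involves the trace of [Sigma].
    - Cross terms. Given the locations and [eps], the variance of
      [eta_j^T P eps] is [var (eta_j) |P eps|^2 = O (n)]. *)

(** The paths of [g] and [h] are only known to be continuous; they need not have moments and may
    depend on each other. They are therefore treated one path at a time, by a bound valid for every
    sequence of points of [D]. The rank from which it holds depends on the path, and continuity of
    the probability along tail unions turns this into a statement in probability. Products of a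
    smooth term with another vector need no estimate of their own: Young's inequality for the
    [P]-form absorbs them.

    The largest eigenvalue of [K] can be of order [n], so that [P] may be as small as a multiple of
    [1 / n] in some directions. The spectrum alone thus gives no useful lower bound for the form of
    [eta b]; the randomness of [eta] has to keep it away from those directions on average.

    In a mixture of Gaussian kernels a single decay has no weight. The functions that approximate
    [g] must therefore have bounded norm for a whole interval of decays at once: the polynomial is
    kept fixed and only the Gaussian factor moves with the decay. *)

(** * Quadratic forms of the Gaussian kernel *)

Definition kernel_form (R : realType) (T : Type) n (K : T -> T -> R)
    (s : 'I_n -> T) (v : 'I_n -> R) : R :=
  \sum_i \sum_j v i * v j * K (s i) (s j).

Definition dotv (R : realType) d (s t : 'rV[R]_d) : R :=
  \sum_a s ord0 a * t ord0 a.

Definition gauss (R : realType) d (a : R) (s t : 'rV[R]_d) : R :=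
  expR (- (a * enorm (s - t) ^+ 2)).

(** A monomial is a word of coordinate indices, because the words of length [k] index the expansion
    of [dotv s t ^+ k]. *)
Definition monomial (R : realType) d (m : seq 'I_d) (s : 'rV[R]_d) : R :=
  \prod_(a <- m) s ord0 a.

Definition poly_eval (R : realType) d (P : seq (R * seq 'I_d)) (s : 'rV[R]_d) : R :=
  \sum_(x <- P) x.1 * monomial x.2 s.

Section gaussian_form.
Context {R : realType} {d n : nat}.
Implicit Types (s : 'I_n -> 'rV[R]_d) (v : 'I_n -> R).

Lemma enorm_sqr m k (A : 'M[R]_(m, k)) :
  enorm A ^+ 2 = \sum_i \sum_j A i j ^+ 2.
Proof.
rewrite sqr_sqrtr//; apply: sumr_ge0 => i _; apply: sumr_ge0 => j _.
exact: sqr_ge0.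
Qed.

Lemma enorm_rV_sqr (x : 'rV[R]_d) : enorm x ^+ 2 = dotv x x.
Proof. by rewrite enorm_sqr big_ord1; apply: eq_bigr => a _; rewrite expr2. Qed.

Lemma dotv_ge0 (x : 'rV[R]_d) : 0 <= dotv x x.
Proof. by apply: sumr_ge0 => a _; rewrite -expr2 sqr_ge0. Qed.

Lemma gaussE (a : R) (x y : 'rV[R]_d) :
  gauss a x y = expR (- (a * dotv x x)) * expR (- (a * dotv y y)) *
    expR (2 * a * dotv x y).
Proof.
rewrite /gauss -!expRD; congr expR.
suff -> : enorm (x - y) ^+ 2 = dotv x x + dotv y y - 2 * dotv x y by ring.
rewrite enorm_rV_sqr /dotv mulr_sumr -big_split/= -sumrB.
by apply: eq_bigr => i _; rewrite !mxE; ring.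
Qed.

Lemma dotv_expE k (x y : 'rV[R]_d) : dotv x y ^+ k =
  \sum_(f : {ffun 'I_k -> 'I_d})
     (\prod_l x ord0 (f l)) * (\prod_l y ord0 (f l)).
Proof.
rewrite /dotv -[in LHS](card_ord k) -prodr_const bigA_distr_bigA/=.
by apply: eq_bigr => f _; rewrite -big_split.
Qed.

Lemma kernel_form_dot_expE k s v :
  kernel_form (fun x y => dotv x y ^+ k) s v =
  \sum_(f : {ffun 'I_k -> 'I_d})
     (\sum_i v i * \prod_l s i ord0 (f l)) ^+ 2.
Proof.
rewrite /kernel_form; under eq_bigr => i _ do under eq_bigr => j _ do
  rewrite dotv_expE mulr_sumr.
under eq_bigr => i _ do rewrite exchange_big.
rewrite exchange_big; apply: eq_bigr => f _ /=.
rewrite expr2 mulr_suml; apply: eq_bigr => i _.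
by rewrite mulr_sumr; apply: eq_bigr => j _; ring.
Qed.

Lemma kernel_form_dot_exp_ge0 k s v :
  0 <= kernel_form (fun x y => dotv x y ^+ k) s v.
Proof.
by rewrite kernel_form_dot_expE; apply: sumr_ge0 => f _; exact: sqr_ge0.
Qed.

(** The form of the polynomial kernel is a sum of squares, one for each word of length [size m];
    only the square of the word [m] is kept. *)
Lemma sqr_monomial_le_dot_exp (m : seq 'I_d) s v :
  (\sum_i v i * monomial m (s i)) ^+ 2 <=
  kernel_form (fun x y => dotv x y ^+ size m) s v.
Proof.
rewrite kernel_form_dot_expE (bigD1 [ffun l => tnth (in_tuple m) l])//=.
have -> : \sum_i v i * monomial m (s i) =
    \sum_i v i * \prod_l s i ord0 ([ffun l => tnth (in_tuple m) l] l).
  apply: eq_bigr => i _; congr (_ * _); rewrite /monomial big_tnth.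
  by apply: eq_bigr => l _; rewrite ffunE.
by rewrite lerDl; apply: sumr_ge0 => f _; exact: sqr_ge0.
Qed.

(** Each power in the exponential series contributes a nonnegative form, so the whole series is at
    least its term of degree [size m]. *)
Lemma sqr_monomial_le_exp_dot (c : R) (m : seq 'I_d) s v : 0 <= c ->
  c ^+ size m / (size m)`!%:R * (\sum_i v i * monomial m (s i)) ^+ 2 <=
  kernel_form (fun x y => expR (c * dotv x y)) s v.
Proof.
move=> c0.
pose F k := c ^+ k / k`!%:R * kernel_form (fun x y => dotv x y ^+ k) s v.
have F0 k : 0 <= F k.
  by rewrite mulr_ge0 ?kernel_form_dot_exp_ge0// divr_ge0 ?exprn_ge0.
have cvgF : series F @ \oo -->
    kernel_form (fun x y => expR (c * dotv x y)) s v.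
  rewrite (_ : series F = fun N => \sum_i \sum_j v i * v j *
      series (exp_coeff (c * dotv (s i) (s j))) N); last first.
    apply/funext => N; rewrite /series/= /F /kernel_form.
    under eq_bigr do rewrite mulr_sumr.
    rewrite exchange_big; apply: eq_bigr => i _ /=.
    under eq_bigr do rewrite mulr_sumr.
    rewrite exchange_big; apply: eq_bigr => j _ /=.
    by rewrite mulr_sumr; apply: eq_bigr => k _; rewrite /exp_coeff/= exprMn; ring.
  apply: cvg_big => [|i _]; first exact: add_continuous.
  apply: cvg_big => [|j _]; first exact: add_continuous.
  apply: cvgMl_tmp.
  exact: is_cvg_series_exp_coeff.
apply: (@le_trans _ _ (F (size m))).
  rewrite ler_wpM2l//; first by rewrite divr_ge0 ?exprn_ge0.
  exact: sqr_monomial_le_dot_exp.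
rewrite -(cvg_lim (@Rhausdorff R) cvgF); apply: limr_ge.
  by apply/cvg_ex; exists (kernel_form (fun x y => expR (c * dotv x y)) s v).
near=> N; rewrite /series/= (big_nat_widen _ _ N)//.
have mN : (size m < N)%N by near: N; exact: nbhs_infty_gt.
rewrite big_mkord (bigD1 (Ordinal mN))//= lerDl.
by apply: sumr_ge0 => i _.
Unshelve. all: by end_near. Qed.

Lemma kernel_form_exp_dot_ge0 (c : R) s v : 0 <= c ->
  0 <= kernel_form (fun x y => expR (c * dotv x y)) s v.
Proof.
move=> c0; apply: le_trans (sqr_monomial_le_exp_dot [::] s v c0).
by rewrite expr0 fact0 divr1 mul1r sqr_ge0.
Qed.

Lemma kernel_form_gaussE (a : R) s v : kernel_form (gauss a) s v =
  kernel_form (fun x y => expR (2 * a * dotv x y)) s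
    (fun i => v i * expR (- (a * dotv (s i) (s i)))).
Proof.
apply: eq_bigr => i _; apply: eq_bigr => j _.
by rewrite gaussE; ring.
Qed.

Lemma kernel_form_gauss_ge0 (a : R) s v : 0 <= a ->
  0 <= kernel_form (gauss a) s v.
Proof.
by move=> a0; rewrite kernel_form_gaussE kernel_form_exp_dot_ge0// mulr_ge0.
Qed.

End gaussian_form.

(* Polynomials times a Gaussian lie in the reproducing kernel Hilbert space of
   the Gaussian kernel, with a norm that is locally uniform in the decay. *)
Lemma sqr_poly_le_gauss (R : realType) d (P : seq (R * seq 'I_d)) (a0 : R) :
  0 < a0 -> exists C : R, 0 <= C /\
  forall n (s : 'I_n -> 'rV[R]_d) (v : 'I_n -> R) a, a0 <= a ->
  (\sum_i v i * (expR (- (a * dotv (s i) (s i))) * poly_eval P (s i))) ^+ 2 <=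
  C * kernel_form (gauss a) s v.
Proof.
move=> a0_gt0; elim: P => [|[c m] P [C [C0 IH]]].
  exists 0; split => // n s v a _.
  rewrite mul0r big1 ?expr0n// => i _.
  by rewrite /poly_eval big_nil !mulr0.
(* Up to [c ^+ 2], the reciprocal of the weight of degree [size m] in the series of
   [expR (2 * a0 * dotv x y)]. This weight grows with the decay, so one constant serves all
   [a >= a0]. *)
pose D := c ^+ 2 * ((size m)`!%:R / (2 * a0) ^+ size m).
have D0 : 0 <= D.
  by rewrite mulr_ge0 ?sqr_ge0// divr_ge0// exprn_ge0// mulr_ge0// ltW.
exists (2 * D + 2 * C); split; first by rewrite addr_ge0// mulr_ge0.
move=> n s v a a0a.
have a_ge0 : 0 <= a by apply: le_trans a0a; exact: ltW.
rewrite (_ : \sum_i _ = c * (\sum_i v i * expR (- (a * dotv (s i) (s i))) *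
    monomial m (s i)) + \sum_i v i * (expR (- (a * dotv (s i) (s i))) *
    poly_eval P (s i))); last first.
  rewrite mulr_sumr -big_split; apply: eq_bigr => i _ /=.
  by rewrite /poly_eval big_cons/=; ring.
set x := \sum_i _; set y := \sum_i v i * (_ * _).
apply: (@le_trans _ _ (2 * (c ^+ 2 * x ^+ 2) + 2 * y ^+ 2)).
  have := sqr_ge0 (c * x - y); nra.
rewrite [leRHS]mulrDl -[2 * D * _]mulrA -[2 * C * _]mulrA.
rewrite lerD// ler_pM2l//; last exact: IH.
rewrite /D -[leRHS]mulrA ler_wpM2l ?sqr_ge0//.
rewrite kernel_form_gaussE.
have a20 : 0 <= 2 * a by rewrite mulr_ge0.
have := sqr_monomial_le_exp_dot m s
  (fun i => v i * expR (- (a * dotv (s i) (s i)))) a20.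
rewrite -/x; set q := kernel_form _ _ _ => xq.
rewrite -ler_pdivrMl; last first.
  by rewrite divr_gt0 ?ltr0n ?fact_gt0// exprn_gt0// mulr_gt0.
apply: le_trans xq; rewrite ler_wpM2r ?sqr_ge0// invf_div.
by rewrite ler_wpM2r ?invr_ge0// lerXn2r ?nnegrE// ?mulr_ge0 ?ler_pM2l// ltW.
Qed.

(** * Uniform approximation by polynomials on a compact set *)

Section weierstrass.
Context {R : realType} {d : nat}.
Implicit Types (f g : 'rV[R]_d -> R) (D : set 'rV[R]_d).

Definition poly_fun f := exists P, forall s, f s = poly_eval P s.

Lemma poly_fun_cst c : poly_fun (fun=> c).
Proof.
exists [:: (c, [::])] => s.
by rewrite /poly_eval big_seq1 /monomial big_nil mulr1.
Qed.

Lemma poly_fun_coord a : poly_fun (fun s => s ord0 a).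
Proof.
exists [:: (1, [:: a])] => s.
by rewrite /poly_eval big_seq1 /monomial big_seq1 mul1r.
Qed.

Lemma poly_funD f g : poly_fun f -> poly_fun g -> poly_fun (fun s => f s + g s).
Proof.
move=> [P fP] [Q gQ]; exists (P ++ Q) => s.
by rewrite fP gQ /poly_eval big_cat.
Qed.

Lemma poly_funM f g : poly_fun f -> poly_fun g -> poly_fun (fun s => f s * g s).
Proof.
move=> [P fP] [Q gQ].
exists [seq (x.1 * y.1, x.2 ++ y.2) | x <- P, y <- Q] => s.
rewrite fP gQ /poly_eval big_allpairs_dep mulr_suml; apply: eq_bigr => x _.
rewrite mulr_sumr; apply: eq_bigr => y _ /=.
by rewrite /monomial big_cat/=; ring.
Qed.

Lemma poly_fun_sum n (F : 'I_n -> 'rV[R]_d -> R) : (forall i, poly_fun (F i)) ->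
  poly_fun (fun s => \sum_i F i s).
Proof.
elim: n F => [|n IH] F pF.
  by under eq_fun do rewrite big_ord0; exact: poly_fun_cst.
under eq_fun do rewrite big_ord_recl.
by apply: poly_funD => //; apply: IH.
Qed.

Lemma continuous_poly_fun f : poly_fun f -> continuous f.
Proof.
move=> [P fP]; rewrite (funext fP).
have cm m : continuous (@monomial R d m).
  apply: continuous_big => [|a _]; first exact: mul_continuous.
  exact: coord_continuous.
apply: continuous_big => [|x _ s]; first exact: add_continuous.
by apply: (@continuousM R _ (fun=> x.1) (monomial x.2) s);
    [exact: cst_continuous|exact: cm].
Qed.

Lemma within_continuous_bounded f D : compact D -> {within D, continuous f} ->
  exists2 B : R, 0 < B & forall s, D s -> `|f s| <= B.
Proof.
move=> cD cf; have [M [Mr fM]] := compact_bounded (continuous_compact cf cD).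
exists (`|M| + 1); first by rewrite ltr_wpDl.
move=> s Ds; apply: (fM (`|M| + 1)); last by exists s.
by rewrite (le_lt_trans (ler_norm _))// ltrDl.
Qed.

Definition poly_approx D f := forall e : R, 0 < e ->
  exists2 g, poly_fun g & forall s, D s -> `|f s - g s| <= e.

Lemma poly_approxD D f g : poly_approx D f -> poly_approx D g ->
  poly_approx D (fun s => f s + g s).
Proof.
move=> af ag e e0; have e20 : 0 < e / 2 by rewrite divr_gt0.
have [p pp fp] := af _ e20; have [q qq gq] := ag _ e20.
exists (fun s => p s + q s); first exact: poly_funD.
move=> s Ds; rewrite opprD addrACA (le_trans (ler_normD _ _))//.
by rewrite (splitr e) lerD// ?fp ?gq.
Qed.

Lemma poly_approxZ D c f : poly_approx D f -> poly_approx D (fun s => c * f s).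
Proof.
move=> af e e0; have c0 : 0 < `|c| + 1 by rewrite ltr_wpDl.
have [p pp fp] := af _ (divr_gt0 e0 c0).
exists (fun s => c * p s); first by apply: poly_funM => //; exact: poly_fun_cst.
move=> s Ds; rewrite -mulrBr normrM.
apply: (@le_trans _ _ ((`|c| + 1) * (e / (`|c| + 1)))).
  by apply: ler_pM => //; [rewrite lerDl | exact: fp].
by rewrite mulrC divfK ?gt_eqF.
Qed.

Lemma poly_fun_approx D f : poly_fun f -> poly_approx D f.
Proof. by move=> pf e e0; exists f => // s _; rewrite subrr normr0 ltW. Qed.

(* The iteration converges to [|x|] on [-1, 1] from below. *)
Fixpoint abs_iter (k : nat) (x : R) : R :=
  if k is k'.+1 then abs_iter k' x + (x ^+ 2 - abs_iter k' x ^+ 2) / 2 else 0.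

(** The defect [z = |x| - p] of an iterate [p] is multiplied by [1 - (|x| + p) / 2], hence becomes
    at most [z * (1 - z / 2)]. This map is increasing on [0, 1] and sends [2 / (k + 2)] below
    [2 / (k + 3)]; the initial defect is at most [1 = 2 / 2]. *)
Lemma abs_iter_bound k x : `|x| <= 1 ->
  0 <= abs_iter k x <= `|x| /\ `|x| - abs_iter k x <= 2 / k.+2%:R.
Proof.
move=> x1; elim: k => [|k [/andP[p0 px] IH]] /=.
  by rewrite lexx normr_ge0 subr0 divff.
have x0 := normr_ge0 x.
rewrite -[x ^+ 2]real_normK ?num_real//.
set y := `|x| in x1 px IH x0 *; set p := abs_iter k x in p0 px IH *.
set z := 2 / k.+2%:R in IH.
have z1 : z <= 1 by rewrite ler_pdivrMr ?mul1r ?ler_nat.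
split; first by apply/andP; split; nra.
apply: (@le_trans _ _ (z * (1 - z / 2))); first by nra.
rewrite -[k.+3]addn1 -[k.+2]addn2 /z -[k.+2]addn2 !natrD.
have k0 : 0 <= k%:R :> R by [].
rewrite -subr_ge0.
have -> : 2 / (k%:R + 2 + 1) - 2 / (k%:R + 2) * (1 - 2 / (k%:R + 2) / 2) =
    2 / ((k%:R + 2 + 1) * (k%:R + 2) ^+ 2) :> R.
  by field; rewrite ?gt_eqF//; lra.
by rewrite divr_ge0// mulr_ge0 ?sqr_ge0//; lra.
Qed.

Lemma poly_fun_abs_iter k f : poly_fun f -> poly_fun (fun s => abs_iter k (f s)).
Proof.
move=> pf; elim: k => [|k IH] /=; first exact: poly_fun_cst.
under eq_fun do rewrite -mulN1r !expr2.
apply: poly_funD => //; apply: poly_funM; last exact: poly_fun_cst.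
apply: poly_funD; first exact: poly_funM.
by apply: poly_funM; [exact: poly_fun_cst|exact: poly_funM].
Qed.

Lemma poly_approx_norm D f : compact D -> poly_approx D f ->
  poly_approx D (fun s => `|f s|).
Proof.
move=> cD af e e0; have e20 : 0 < e / 2 by rewrite divr_gt0.
have [p pp fp] := af _ e20.
have [B B0 pB] := within_continuous_bounded cD
  (continuous_subspaceT (continuous_poly_fun pp)).
have [k Bk] : exists k : nat, B * (2 / k.+2%:R) <= e / 2.
  exists (Num.truncn (B * 4 / e)); set k := Num.truncn _.
  have : B * 4 / e < k.+1%:R by exact: truncnS_gt.
  rewrite ltr_pdivrMr// => Bk.
  rewrite mulrA ler_pdivrMr ?ltr0n//.
  have : k.+1%:R <= k.+2%:R :> R by rewrite ler_nat.
  nra.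
(* The iteration is controlled on [-1, 1] only, hence the rescaling by a bound [B] of [|p|] on
   [D]. *)
pose q s := B * abs_iter k (B^-1 * p s).
have pq : poly_fun q.
  apply: poly_funM; first exact: poly_fun_cst.
  by apply: poly_fun_abs_iter; apply: poly_funM => //; exact: poly_fun_cst.
exists q => // s Ds.
have -> : `|f s| - q s = (`|f s| - `|p s|) + (`|p s| - q s) by ring.
rewrite (le_trans (ler_normD _ _))// (splitr e) lerD//.
  by rewrite (le_trans (ler_dist_dist _ _))// fp.
have y1 : `|B^-1 * p s| <= 1.
  by rewrite normrM gtr0_norm ?invr_gt0// ler_pdivrMl// mulr1 pB.
have -> : `|p s| - q s = B * (`|B^-1 * p s| - abs_iter k (B^-1 * p s)).
  rewrite mulrBr; congr (_ - _).
  by rewrite normrM gtr0_norm ?invr_gt0// mulrA divff ?gt_eqF// mul1r.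
have [/andP[_ h1] h2] := abs_iter_bound k y1.
rewrite normrM gtr0_norm// ger0_norm ?subr_ge0//.
by apply: le_trans Bk; rewrite ler_pM2l.
Qed.

Lemma poly_approx_min D f g : compact D -> poly_approx D f -> poly_approx D g ->
  poly_approx D (fun s => Num.min (f s) (g s)).
Proof.
move=> cD af ag; under eq_fun do rewrite minr_absE mulrC.
apply: poly_approxZ.
have afg : poly_approx D (fun s => f s + (-1) * g s).
  by apply: poly_approxD => //; exact: poly_approxZ.
rewrite (_ : (fun _ => _) = fun s => f s + g s + (-1) * `|f s + (-1) * g s|).
  apply: poly_approxD; first exact: poly_approxD.
  by apply: poly_approxZ; exact: poly_approx_norm.
by apply/funext => s; rewrite !mulN1r.
Qed.

Lemma coord_sqr_le_dotv (x : 'rV[R]_d) a : x ord0 a ^+ 2 <= dotv x x.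
Proof.
rewrite /dotv (bigD1 a)//= -expr2 lerDl; apply: sumr_ge0 => i _.
by rewrite -expr2 sqr_ge0.
Qed.

(* A continuous function is squeezed by finite minima of the paraboloids
   [f x + e + L * |s - x|^2], which touch it up to [e] at their centers. *)
Theorem weierstrass D f : compact D -> {within D, continuous f} ->
  poly_approx D f.
Proof.
move=> cD cf; have [B B0 fB] := within_continuous_bounded cD cf.
suff near (e : R) : 0 < e -> exists2 F, poly_approx D F &
    forall s, D s -> f s <= F s <= f s + e.
  move=> e e0; have e20 : 0 < e / 2 by rewrite divr_gt0.
  have [F aF fF] := near _ e20; have [p pp Fp] := aF _ e20.
  exists p => // s Ds; have /andP[? ?] := fF _ Ds.
  have := Fp _ Ds; rewrite !ler_norml => /andP[? ?]; apply/andP; split; lra.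
move=> e0; pose bowl (c : 'rV[R]_d * R) s :=
  f c.1 + e / 3 + c.2 * dotv (s - c.1) (s - c.1).
have pbowl c : poly_fun (bowl c).
  apply: poly_funD; first exact: poly_fun_cst.
  apply: poly_funM; first exact: poly_fun_cst.
  have pc a : poly_fun (fun s : 'rV[R]_d => (s - c.1) ord0 a).
    under eq_fun do rewrite !mxE.
    by apply: poly_funD; [exact: poly_fun_coord|exact: poly_fun_cst].
  by apply: poly_fun_sum => a; exact: poly_funM.
pose above c := forall s, D s -> f s <= bowl c s.
pose covers (l : seq ('rV[R]_d * R)) s := D s ->
  exists c, [/\ c \in l, above c & bowl c s <= f s + e].
(* The filter generated by the sets of all lists extending a given one. Along it every center
   eventually belongs to the list, so the near-covering form of compactness returns one finite list
   that covers [D]. *)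
pose F : set_system (seq ('rV[R]_d * R)) :=
  fun A => exists l0 : seq _, forall l, {subset l0 <= l} -> A l.
have FF : Filter F.
  split; first by exists [::].
    move=> U V [l lU] [k kV]; exists (l ++ k) => m lm; split.
      by apply: lU => c cl; apply: lm; rewrite mem_cat cl.
    by apply: kV => c ck; apply: lm; rewrite mem_cat ck orbT.
  by move=> U V UV [l lU]; exists l => m lm; exact/UV/lU.
have [l0 /(_ l0 (fun _ => id)) cover0] : \forall l \near F, D `<=` covers l.
  have /compact_near_coveringP cD' := cD.
  apply: (cD' _ F covers) => x Dx.
  have /subspace_continuousP/(_ x Dx)/cvgrPdist_lt/(_ (e / 3)) := cf.
  have e30 : 0 < e / 3 by rewrite divr_gt0.
  move=> /(_ e30); rewrite near_withinE.
  move=> fxD.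
  have {fxD}fx : \forall s \near x, D s -> `|f x - f s| < e / 3 by exact: fxD.
  have /nbhs_ballP[r /= r0 fxr] := fx.
  (* Inside the ball the margin [e / 3] keeps the bowl above [f]. Outside it the quadratic term is
     at least [2 * B], which bounds the oscillation of [f] on [D]. *)
  pose c : 'rV[R]_d * R := (x, 2 * B / r ^+ 2).
  have c0 : 0 < c.2 by rewrite divr_gt0 ?exprn_gt0// mulr_gt0.
  have ac : above c.
    move=> s Ds; rewrite /bowl [c.1]/=.
    have [xs|] := pselect (ball x r s).
      have := fxr _ xs Ds; rewrite distrC ltr_norml => /andP[_ ?].
      have : 0 <= c.2 * dotv (s - x) (s - x).
        by rewrite mulr_ge0 ?dotv_ge0// ltW.
      by lra.
    move=> /not_andP[//|/existsNP[i /existsNP[a]]].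
    rewrite (ord1 i) /ball/= => /negP; rewrite -leNgt => rx.
    have : r ^+ 2 <= dotv (s - x) (s - x).
      apply: le_trans (coord_sqr_le_dotv _ a).
      rewrite !mxE -[leRHS]real_normK ?num_real// distrC.
      by rewrite lerXn2r// nnegrE ltW.
    rewrite -(ler_pM2l c0) {1}/c/= divfK ?gt_eqF ?exprn_gt0// => ?.
    have := fB _ Ds; have := fB _ Dx.
    by rewrite !ler_norml => /andP[? ?] /andP[? ?]; lra.
  have bx : \forall s \near x, bowl c s < f x + 2 * e / 3.
    have bcx : bowl c s @[s --> x] --> bowl c x by exact: continuous_poly_fun.
    apply: (cvgr_lt _ bcx).
    rewrite /bowl subrr /dotv big1 => [|a _]; last by rewrite mxE mul0r.
    by rewrite /=; lra.
  exists ([set s : 'rV[R]_d | bowl c s < f x + 2 * e / 3 /\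
      (D s -> `|f x - f s| < e / 3)], fun l : seq ('rV[R]_d * R) => is_true (c \in l)).
    split; first exact: filterI.
    by exists [:: c] => l; apply; rewrite mem_head.
  move=> [s l] [/= [bs fs] cl] Ds; exists c; split => //.
  by have := fs Ds; rewrite ltr_norml => /andP[? ?]; lra.
(* A center of [l0] need not give a bowl above [f]; those that do not are skipped in the minimum,
   which starts from the constant [B]. *)
suff [G aG [fG Gf]] : exists2 G, poly_approx D G &
    (forall s, D s -> f s <= G s) /\
    (forall s c, D s -> c \in l0 -> above c -> G s <= bowl c s).
  exists G => // s Ds; rewrite fG//=.
  have [c [cl ac]] := cover0 _ Ds Ds; apply: le_trans; exact: Gf.
elim: l0 {cover0} => [|c l [G aG [fG Gf]]].
  exists (fun=> B); first exact/poly_fun_approx/poly_fun_cst.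
  by split => // s Ds; rewrite (le_trans (ler_norm _))// fB.
have [ac|nac] := pselect (above c); last first.
  exists G => //; split => // s c' Ds; rewrite in_cons => /predU1P[->//|].
  exact: Gf.
exists (fun s => Num.min (bowl c s) (G s)).
  by apply: poly_approx_min => //; exact: poly_fun_approx.
split => [s Ds|s c' Ds]; first by rewrite le_min ac// fG.
rewrite in_cons => /predU1P[-> _|c'l ac'].
  by rewrite ge_min lexx.
by rewrite ge_min Gf// orbT.
Qed.

End weierstrass.

(* The native space of [K] contains, up to a locally uniform constant, an
   average of the native spaces of the Gaussian kernels with decay near [a0]. *)
Definition gauss_dominated (R : realType) d (K : 'rV[R]_d -> 'rV[R]_d -> R) :=
  exists2 a0 : R, 0 < a0 & forall e : R, 0 < e -> exists2 C : R, 0 < C &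
  forall n (s : 'I_n -> 'rV[R]_d) (v : 'I_n -> R) (b : R),
    (forall a, a0 <= a <= a0 + e -> b <= kernel_form (gauss a) s v) ->
    b <= C * kernel_form K s v.

(** * Continuous functions and the native space of a dominating kernel *)

Section gauss_dominated.
Context {R : realType} {d : nat}.
Variable K : 'rV[R]_d -> 'rV[R]_d -> R.
Hypothesis domK : gauss_dominated K.

(** Domination at [b = 0]: the positivity of the Gaussian forms passes to [K]. *)
Lemma gauss_dominated_psd n (s : 'I_n -> 'rV[R]_d) (v : 'I_n -> R) :
  0 <= kernel_form K s v.
Proof.
have [a0 a0_gt0 dom] := domK; have [C C0 domC] := dom 1 ltr01.
rewrite -(pmulr_rge0 _ C0); apply: domC => a /andP[a0a _].
by apply: kernel_form_gauss_ge0; rewrite (le_trans _ a0a)// ltW.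
Qed.

Lemma gauss_decay_lipschitz (q a0 a : R) : 0 <= q -> 0 <= a0 <= a ->
  `|expR (- (a0 * q)) - expR (- (a * q))| <= (a - a0) * q.
Proof.
move=> q0 /andP[a0_ge0 a0a].
have -> : - (a * q) = - (a0 * q) - (a - a0) * q by ring.
have aq0 : 0 <= (a - a0) * q by rewrite mulr_ge0// subr_ge0.
rewrite expRD; set y := (a - a0) * q in aq0 *.
have h1 : expR (- (a0 * q)) <= 1.
  by rewrite -expR0 ler_expR oppr_le0 mulr_ge0.
have h2 := expR_ge0 (- (a0 * q)).
have h3 : expR (- y) <= 1 by rewrite -expR0 ler_expR oppr_le0.
have := expR_ge1Dx (- y) => h4.
rewrite ger0_norm; nra.
Qed.

Lemma sum_mul_le_sqr n (v r : 'I_n -> R) (t m : R) : 0 < t ->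
  (forall i, `|r i| <= m) ->
  2 * (\sum_i v i * r i) <= t * (\sum_i v i ^+ 2) + n%:R * (m ^+ 2 / t).
Proof.
move=> t0 rm.
have -> : n%:R * (m ^+ 2 / t) = \sum_(i < n) (m ^+ 2 / t).
  by rewrite sumr_const card_ord mulr_natl.
rewrite !mulr_sumr -big_split/=; apply: ler_sum => i _.
have rm2 : r i ^+ 2 <= m ^+ 2.
  by rewrite -[leLHS]real_normK ?num_real// lerXn2r// nnegrE (le_trans _ (rm i)).
have : r i ^+ 2 / t <= m ^+ 2 / t by rewrite ler_pM2r ?invr_gt0.
have : 0 <= t^-1 * (t * v i - r i) ^+ 2 by rewrite mulr_ge0 ?sqr_ge0// invr_ge0 ltW.
have -> : t^-1 * (t * v i - r i) ^+ 2 =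
    t * v i ^+ 2 - 2 * (v i * r i) + r i ^+ 2 / t.
  by field; rewrite gt_eqF.
lra.
Qed.

(* For every [a] close to [a0], [f] is uniformly close to a polynomial times
   the Gaussian [exp (- a |s|^2)]; these functions have a norm bounded
   uniformly in [a]. *)
Lemma continuous_native_bound (D : set 'rV[R]_d) (f : 'rV[R]_d -> R) (t e : R) :
  compact D -> {within D, continuous f} -> 0 < t -> 0 < e ->
  exists C : R, forall n (s : 'I_n -> 'rV[R]_d) (v : 'I_n -> R),
    (forall i, D (s i)) ->
    2 * (\sum_i v i * f (s i)) <=
      kernel_form K s v + t * (\sum_i v i ^+ 2) + C + n%:R * e.
Proof.
move=> cD cf t0 e0.
have [a0 a0_gt0 dom] := domK.
(* The residual will be at most [2 * m], and Young's inequality charges [(2 * m) ^+ 2 / t] per point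
   for it. This is at most [e] since [m <= 1] and [4 * m <= e * t]. *)
pose m := Num.min 1 (e * t / 4).
have m0 : 0 < m by rewrite lt_min ltr01 divr_gt0// mulr_gt0.
have m1 : m <= 1 by rewrite ge_min lexx.
have met : 4 * m <= e * t.
  by have : m <= e * t / 4 by [rewrite ge_min lexx orbT]; lra.
pose q (s : 'rV[R]_d) := dotv s s.
have q0 s : 0 <= q s by exact: dotv_ge0.
have pq : poly_fun q.
  by apply: poly_fun_sum => a; apply: poly_funM; exact: poly_fun_coord.
have cq := continuous_poly_fun pq.
(* The Gaussian factor is divided out first, so that only a polynomial remains to be found. *)
have cfq : {within D, continuous (fun s => f s * expR (a0 * q s))}.
  have cexp : {within D, continuous (fun s => expR (a0 * q s))}.
    apply: continuous_subspaceT => x.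
    apply: (@continuous_comp _ _ _ (fun s => a0 * q s) expR).
      apply: (continuous_poly_fun _).
      by apply: poly_funM => //; exact: poly_fun_cst.
    exact: continuous_expR.
  by move=> x; exact: (@continuousM R (subspace D) f _ x (cf x) (cexp x)).
have [p [P pP] fp] := weierstrass cD cfq m0.
have pp : poly_fun p by exists P.
have [B1 B1_gt0 pB1] := within_continuous_bounded cD
  (continuous_subspaceT (continuous_poly_fun pp)).
have [B2 B2_gt0 qB2] := within_continuous_bounded cD (continuous_subspaceT cq).
have [C1 [C1_ge0 polyC1]] := sqr_poly_le_gauss P a0_gt0.
(* An interval of decays this short costs at most [m] when [expR (- (a0 * q s))] is replaced by
   [expR (- (a * q s))] in front of the polynomial. *)
have w0 : 0 < m / (B1 * B2) by rewrite divr_gt0// mulr_gt0.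
have [C2 C2_gt0 domC2] := dom _ w0.
exists (C1 * C2) => n s v Ds.
set F := \sum_i v i * f (s i); set V := \sum_i v i ^+ 2.
(* Domination multiplies the form of [K] by [C2], so the claim is scaled by [C2] before it is
   compared with each Gaussian form. *)
have : C2 * (2 * F - t * V - n%:R * e - C1 * C2) <= C2 * kernel_form K s v.
  apply: domC2 => a /andP[a0a aw].
  pose r i := f (s i) - expR (- (a * q (s i))) * p (s i).
  have r2m i : `|r i| <= 2 * m.
    have -> : r i = expR (- (a0 * q (s i))) *
        (f (s i) * expR (a0 * q (s i)) - p (s i)) +
      (expR (- (a0 * q (s i))) - expR (- (a * q (s i)))) * p (s i).
      have : expR (- (a0 * q (s i))) * expR (a0 * q (s i)) = 1.
        by rewrite -expRD addNr expR0.
      rewrite /r; set E := expR (- (a0 * _)); set E' := expR (a0 * _) => EE.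
      by transitivity ((E * E') * f (s i) - expR (- (a * q (s i))) * p (s i));
        [rewrite EE; ring|ring].
    rewrite (le_trans (ler_normD _ _))// mulr_natl mulr2n lerD//.
      rewrite normrM ger0_norm ?expR_ge0// -[leRHS]mul1r.
      apply: ler_pM; rewrite ?expR_ge0//; last exact: fp.
      by rewrite -expR0 ler_expR oppr_le0 mulr_ge0// ltW.
    rewrite normrM; apply: (@le_trans _ _ (m / (B1 * B2) * B2 * B1)).
      apply: ler_pM => //; last exact: pB1.
      apply: le_trans (gauss_decay_lipschitz _ _) _ => //.
        by rewrite ltW.
      apply: ler_pM => //; first by rewrite subr_ge0.
        by rewrite lerBlDl.
      by rewrite (le_trans (ler_norm _))// qB2.
    by rewrite -mulrA [B2 * B1]mulrC divfK// gt_eqF// mulr_gt0.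
  have := sum_mul_le_sqr v t0 r2m.
  have := polyC1 n s v a a0a.
  under eq_bigr do rewrite -pP -/(q _).
  set Z := \sum_i _; set Q := kernel_form _ _ _; set W := \sum_i _ * r i.
  have -> : F = Z + W.
    rewrite -big_split; apply: eq_bigr => i _ /=.
    by rewrite /r; ring.
  move=> ZQ WV.
  have Q0 : 0 <= Q by apply: kernel_form_gauss_ge0; rewrite (le_trans _ a0a)// ltW.
  have ne : n%:R * ((2 * m) ^+ 2 / t) <= n%:R * e.
    rewrite ler_wpM2l// ler_pdivrMr//.
    have : m ^+ 2 <= m by rewrite expr2 ger_pMr.
    rewrite exprMn; lra.
  (* From [Z ^+ 2 <= C1 * Q]: the square of the left side is at most [4 * Q * (C1 * C2 ^+ 2)], hence
     at most the square of the right side. *)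
  have : 2 * Z * C2 <= Q + C1 * C2 ^+ 2.
    have : 0 <= C1 * C2 ^+ 2 by rewrite mulr_ge0 ?sqr_ge0.
    move=> CC.
    rewrite leNgt; apply/negP => lt.
    have : (Q + C1 * C2 ^+ 2) ^+ 2 < (2 * Z * C2) ^+ 2.
      by rewrite ltrXn2r// ?nnegrE ?addr_ge0// (le_trans _ (ltW lt))// addr_ge0.
    have : C2 ^+ 2 * Z ^+ 2 <= C2 ^+ 2 * (C1 * Q) by rewrite ler_wpM2l ?sqr_ge0.
    have := sqr_ge0 (Q - C1 * C2 ^+ 2).
    by rewrite !exprMn; nra.
  rewrite -/V in WV.
  have : C2 * (2 * W) <= C2 * (t * V + n%:R * e).
    rewrite ler_pM2l//; lra.
  lra.
by rewrite ler_pM2l//; lra.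
Qed.

End gauss_dominated.

(** * Changes of variables in integrals over the real line *)

Section line_integrals.
Context {R : realType}.
Notation mu := (@lebesgue_measure R).
Local Open Scope ereal_scope.

Lemma ge0_integral_fold (f : R -> R) : measurable_fun [set: R] f ->
  (forall u, (0 <= f u)%R) ->
  \int[mu]_u (f u)%:E = \int[mu]_(u in `[0%R, +oo[) (f u + f (- u))%:E.
Proof.
move=> mf f0.
have mEf : measurable_fun setT (EFin \o f) by exact/measurable_EFinP.
have mEfN : measurable_fun setT (EFin \o (f \o -%R)).
  by apply/measurable_EFinP; apply: measurableT_comp.
have -> : [set: R] = `]-oo, 0%R[ `|` `[0%R, +oo[ :> set R.
  by rewrite -itv_bndbnd_setU ?bnd_simp// set_itvNyy.
rewrite ge0_integral_setU//=; last 3 first.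
  by rewrite -itv_bndbnd_setU ?bnd_simp// set_itvNyy.
  by move=> u _; rewrite lee_fin.
  apply/disj_setPS => x [/=]; rewrite !in_itv/= andbT => x0.
  by rewrite leNgt x0.
rewrite integral_itv_bndo_bndc; last exact: measurable_funS mEf.
rewrite -[X in X + _](_ : \int[mu]_(u in `[0%R, +oo[) (f (- u))%:E = _); last first.
  rewrite (ge0_integration_by_substitution0 mEfN) => [|u]; last first.
    by rewrite lee_fin /=.
  by apply: eq_integral => u _; rewrite /= opprK.
rewrite addeC; under [RHS]eq_integral do rewrite EFinD.
rewrite ge0_integralD//=.
- by move=> u _; rewrite lee_fin.
- exact: measurable_funS mEf.
- by move=> u _; rewrite lee_fin.
- exact: measurable_funS mEfN.
Qed.

Lemma ge0_integral_translate (f : R -> R) (c : R) : continuous f ->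
  (forall u, (0 <= f u)%R) ->
  \int[mu]_u (f u)%:E = \int[mu]_u (f (u + c)%R)%:E.
Proof.
move=> cf f0.
have dF x : derivable (fun u : R => (u + c)%R) x 1 by exact: ex_derive.
have dF1 : derive1 (fun u : R => (u + c)%R) = cst (1%R : R).
  apply/funext => x; rewrite derive1E.
  by rewrite (@deriveD _ _ _ id (cst c))// derive_id derive_cst addr0.
rewrite (@increasing_ge0_integration_by_substitutionT R (fun u => (u + c)%R) f).
- by apply: eq_integral => u _; rewrite /= dF1/= fctE/= mulr1.
- by move=> x y xy; rewrite ltrD2r.
- by rewrite dF1 => x; exact: cvg_cst.
- by rewrite dF1; exact: is_cvg_cst.
- by rewrite dF1; exact: is_cvg_cst.
- exact: dF.
- exact: cvg_addrr_Ny.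
- exact: cvg_addrr.
- exact: cf.
- exact: f0.
Qed.

(** The increasing substitution is made on the compact intervals [[-n, n]], and both sides pass to
    the limit by monotone convergence. *)
Lemma ge0_integral_expR_subst (f : R -> R) :
  {in `]0%R, +oo[, continuous f} -> (forall t, (0 <= f t)%R) ->
  \int[mu]_(t in `]0%R, +oo[) (f t)%:E =
  \int[mu]_u (f (expR u) * expR u)%:E.
Proof.
move=> cf f0.
pose I (n : nat) : set R := `[- n%:R, n%:R]%classic%R.
pose J (n : nat) : set R := `[expR (- n%:R), expR n%:R]%classic%R.
have IJ n : \int[mu]_(t in J n) (f t)%:E =
    \int[mu]_(u in I n) (f (expR u) * expR u)%:E.
  have dexp : derive1 (@expR R) = expR.
    by apply/funext => u; rewrite derive1E derive_val.
  have cexp (x : R) : expR u @[u --> x] --> expR x by exact: continuous_expR.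
  rewrite (@integration_by_substitution_increasing R expR f (- n%:R) n%:R)%R//.
  - by apply: eq_integral => u _; rewrite fctE/= dexp.
  - by rewrite (@le_trans _ _ 0%R)// oppr_le0.
  - by move=> x y _ _; rewrite ltr_expR.
  - by rewrite dexp => x _; exact: continuous_expR.
  - by rewrite dexp; apply/cvg_ex; exists (expR (- n%:R)); exact: cvg_at_right_filter.
  - by rewrite dexp; apply/cvg_ex; exists (expR n%:R); exact: cvg_at_left_filter.
  - split; first by move=> x _; exact: derivable_expR.
      exact: cvg_at_right_filter.
    exact: cvg_at_left_filter.
  - apply: continuous_in_subspaceT => x; rewrite inE/= in_itv/= => /andP[nx _].
    by apply: cf; rewrite in_itv/= andbT (lt_le_trans _ nx)// expR_gt0.
have mf : measurable_fun (`]0%R, +oo[%classic : set R) f.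
  apply: open_continuous_measurable_fun; first exact: interval_open.
  by move=> x; rewrite inE => /cf.
have mfexp : measurable_fun [set: R] (fun u => f (expR u) * expR u)%R.
  apply: continuous_measurable_fun => u.
  apply: (@continuousM R R (f \o expR) expR u); last exact: continuous_expR.
  apply: continuous_comp; first exact: continuous_expR.
  by apply: cf; rewrite in_itv/= andbT expR_gt0.
have UJ : \bigcup_n J n = `]0%R, +oo[%classic :> set R.
  apply/seteqP; split=> [x [n _]|x]; rewrite /J/= !in_itv/= andbT.
    by case/andP => nx _; rewrite (lt_le_trans _ nx)// expR_gt0.
  move=> x0; exists (Num.truncn `|ln x|).+1 => //; rewrite /J/= in_itv/=.
  rewrite -{2 3}(lnK x0) !ler_expR -ler_norml ltW//.
  exact: truncnS_gt.
have UI : \bigcup_n I n = [set: R].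
  apply/seteqP; split=> // x _; exists (Num.truncn `|x|).+1 => //.
  by rewrite /I/= in_itv/= -ler_norml ltW// truncnS_gt.
have limJ : \int[mu]_(t in J n) (f t)%:E @[n --> \oo] -->
    \int[mu]_(t in `]0%R, +oo[) (f t)%:E.
  rewrite -UJ; apply: ge0_nondecreasing_set_cvg_integral => //.
  - apply/nondecreasing_seqP => n; rewrite subsetEset; apply: subset_itv.
      by rewrite bnd_simp ler_expR lerN2 ler_nat.
    by rewrite bnd_simp ler_expR ler_nat.
  - by move=> n; exact: measurable_itv.
  - move=> n; apply/measurable_EFinP; apply: measurable_funS mf => //.
    by rewrite -UJ; exact: bigcup_sup.
  - by move=> n x _; rewrite lee_fin.
have limI : \int[mu]_(u in I n) (f (expR u) * expR u)%:E @[n --> \oo] -->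
    \int[mu]_u (f (expR u) * expR u)%:E.
  rewrite -UI; apply: ge0_nondecreasing_set_cvg_integral => //.
  - apply/nondecreasing_seqP => n; rewrite subsetEset; apply: subset_itv.
      by rewrite bnd_simp lerN2 ler_nat.
    by rewrite bnd_simp ler_nat.
  - by move=> n; exact: measurable_itv.
  - by move=> n; apply/measurable_EFinP; apply: measurable_funS mfexp.
  - by move=> n x _; rewrite lee_fin mulr_ge0// expR_ge0.
move: limJ; rewrite (funext IJ) => limJ.
exact: (cvg_unique (@ereal_hausdorff R) limJ limI).
Qed.

End line_integrals.

(* Integrand of [Gamma nu] and [besselK nu r] in the logarithmic variable,
   i.e. after substituting [t = expR u] in [t^(nu-1) exp (- t - r^2/(4t))]. *)
Definition matern_density (R : realType) (nu r u : R) : R :=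
  expR (nu * u - expR u - r ^+ 2 / 4 * expR (- u)).

Section Rintegral_sum.
Context d (T : measurableType d) (R : realType) (mu : {measure set T -> \bar R}).

Lemma Rintegrable_sum n (F : 'I_n -> T -> R) :
  (forall i, mu.-integrable setT (EFin \o F i)) ->
  mu.-integrable setT (EFin \o (fun x => \sum_i F i x)).
Proof.
move=> iF; rewrite (_ : _ \o _ = fun x => (\sum_i (EFin \o F i) x)%E).
  exact: integrable_sum.
by apply/funext => x /=; rewrite sumEFin.
Qed.

Lemma Rintegral_sum n (F : 'I_n -> T -> R) :
  (forall i, mu.-integrable setT (EFin \o F i)) ->
  \int[mu]_x (\sum_i F i x) = \sum_i \int[mu]_x F i x.
Proof.
move=> iF; apply: EFin_inj; rewrite fineK; last first.
  exact/integrable_fin_num/Rintegrable_sum.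
rewrite -sumEFin; under eq_integral do rewrite -sumEFin.
rewrite integral_sum//; apply: eq_bigr => i _.
by apply/esym; rewrite fineK//; exact/integrable_fin_num/iF.
Qed.

Lemma RintegrableZl (c : R) (f : T -> R) :
  mu.-integrable setT (EFin \o f) ->
  mu.-integrable setT (EFin \o (fun x => c * f x)).
Proof. by move=> fi; exact: (integrableZl measurableT c fi). Qed.

End Rintegral_sum.

Lemma measurable_cosh (R : realType) : measurable_fun [set: R] (@cosh R).
Proof.
apply: measurable_funM => //; apply: measurable_funD => //.
by apply: measurableT_comp.
Qed.

(** * The Matern kernel as a mixture of Gaussian kernels *)

Section matern_density.
Context {R : realType}.
Notation mu := (@lebesgue_measure R).
Variable nu : R.
Hypothesis nu_gt0 : 0 < nu.
Implicit Types r u : R.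

Lemma matern_density_ge0 r u : 0 <= matern_density nu r u.
Proof. exact: expR_ge0. Qed.

Lemma continuous_matern_density r : continuous (matern_density nu r).
Proof.
move=> u; apply: continuous_comp; last exact: continuous_expR.
apply: (@continuousB R R R (fun u => nu * u - expR u)
  (fun u => r ^+ 2 / 4 * expR (- u))).
  apply: (@continuousB R R R (fun u => nu * u) expR); last exact: continuous_expR.
  exact: mulrl_continuous.
apply: continuous_comp; last exact: mulrl_continuous.
by apply: continuous_comp; [exact: opp_continuous|exact: continuous_expR].
Qed.

Lemma measurable_matern_density r : measurable_fun [set: R] (matern_density nu r).
Proof. by apply: continuous_measurable_fun; exact: continuous_matern_density. Qed.

Lemma integrable_expR_rate (k : R) : 0 < k ->
  mu.-integrable `[0, +oo[ (EFin \o (fun u => expR (- k * u))).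
Proof.
move=> k0.
have h : mu.-integrable `[0, +oo[ (EFin \o exponential_pdf k).
  by apply: integrableS (integrable_exponential_pdf k0); last exact: subsetT.
have : mu.-integrable `[0, +oo[ (fun u => k^-1%:E * (EFin \o exponential_pdf k) u)%E.
  by apply: integrableZl h; exact: measurable_itv.
apply: eq_integrable => [|u]; first exact: measurable_itv.
rewrite /= inE/= in_itv/= andbT => u0.
by rewrite exponential_pdfE// -EFinM mulrA mulVf ?mul1r ?gt_eqF.
Qed.

(** The constant is the exponential of the maximum of [(nu + 1) * u - expR u], reached at
    [u = ln (nu + 1)]. Raising [nu] by 1 is what leaves the integrable factor [expR (- u)]. *)
Lemma matern_density0_le u : 0 <= u -> matern_density nu 0 u <=
  expR (- ((nu + 1) * (1 - ln (nu + 1)))) * expR (- 1 * u).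
Proof.
move=> u0; rewrite /matern_density expr0n/= !mul0r subr0 -expRD ler_expR.
have n0 : 0 < nu + 1 by rewrite addr_gt0.
have := expR_ge1Dx (u - ln (nu + 1)).
rewrite -(ler_pM2l n0) -{3}(lnK n0) -expRD [ln _ + _]addrC subrK.
by lra.
Qed.

Lemma matern_density_antitone r u : matern_density nu r u <= matern_density nu 0 u.
Proof.
rewrite /matern_density ler_expR lerB// expr0n/= !mul0r.
by rewrite mulr_ge0 ?expR_ge0// divr_ge0// sqr_ge0.
Qed.

(** Dominated by the case [r = 0], folded at 0: the right half decays like [expR (- u)] and the left
    half like [expR (- nu * u)], which is where [0 < nu] enters. *)
Lemma integrable_matern_density r :
  mu.-integrable setT (EFin \o matern_density nu r).
Proof.
apply: (@le_integrable _ _ _ mu setT _ _ (EFin \o matern_density nu 0)) => //.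
- by apply/measurable_EFinP; exact: measurable_matern_density.
- move=> u _ /=; rewrite lee_fin !ger0_norm ?matern_density_ge0//.
  exact: matern_density_antitone.
apply/integrableP; split.
  by apply/measurable_EFinP; exact: measurable_matern_density.
under eq_integral do rewrite gee0_abs ?lee_fin ?matern_density_ge0//=.
rewrite ge0_integral_fold; last 2 first.
- exact: measurable_matern_density.
- by move=> u; exact: matern_density_ge0.
set c := expR (- ((nu + 1) * (1 - ln (nu + 1)))).
have /integrableP[mg] : mu.-integrable `[0, +oo[
    ((fun u => c%:E * (EFin \o (fun u => expR (- 1 * u))) u)%E \+
     (EFin \o (fun u => expR (- nu * u))))%E.
  apply: integrableD; first exact: measurable_itv.
    by apply: integrableZl (integrable_expR_rate ltr01); exact: measurable_itv.
  exact: integrable_expR_rate.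
apply: le_lt_trans; apply: ge0_le_integral => //.
- by move=> u _; rewrite lee_fin addr_ge0// matern_density_ge0.
- apply/measurable_EFinP; apply: measurable_funTS.
  apply: measurable_funD; first exact: measurable_matern_density.
  by apply: measurableT_comp => //; exact: measurable_matern_density.
- exact: measurableT_comp.
move=> u; rewrite /= in_itv/= andbT => u0.
rewrite lee_fin ger0_norm ?addr_ge0 ?mulr_ge0 ?expR_ge0//.
rewrite lerD ?matern_density0_le// /matern_density ler_expR.
by rewrite expr0n/= !mul0r subr0 mulrN mulNr lerBlDr lerDl expR_ge0.
Qed.

Definition matern_mixture r : R := \int[mu]_u matern_density nu r u.

Lemma Gamma_mixture : Gamma nu = matern_mixture 0.
Proof.
rewrite /Gamma /Rintegral ge0_integral_expR_subst.
- congr fine; apply: eq_integral => u _; congr EFin.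
  rewrite /matern_density expr0n/= !mul0r subr0 -expRM -!expRD.
  by congr expR; ring.
- move=> t t0.
  have c1 : {for t, continuous (fun t : R => t `^ (nu - 1))}.
    by apply: differentiable_continuous; apply/derivable1_diffP; exact: derivable_powR.
  have c2 : {for t, continuous (fun t : R => expR (- t))}.
    by apply: continuous_comp; [exact: opp_continuous|exact: continuous_expR].
  exact: (continuousM c1 c2).
- by move=> t; rewrite mulr_ge0 ?powR_ge0 ?expR_ge0.
Qed.

(** Centering the variable at [ln (r / 2)] balances the two exponentials:
    [expR u + r ^+ 2 / 4 * expR (- u)] becomes [r * cosh u]. Folding at 0 then turns [expR (nu * u)]
    into [2 * cosh (nu * u)]. *)
Lemma besselK_mixture r : 0 < r ->
  matern_mixture r = 2 * (r / 2) `^ nu * besselK nu r.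
Proof.
move=> r0; have r20 : 0 < r / 2 by rewrite divr_gt0.
rewrite /matern_mixture /Rintegral.
rewrite (@ge0_integral_translate _ _ (ln (r / 2))); last 2 first.
- exact: continuous_matern_density.
- by move=> u; exact: matern_density_ge0.
have shift u : matern_density nu r (u + ln (r / 2)) =
    (r / 2) `^ nu * expR (nu * u - r * cosh u).
  rewrite /matern_density opprD (expRD u) (expRD (- u)) (expRN (ln _)) lnK//.
  by rewrite /powR (gt_eqF r20) -expRD /cosh; congr expR; field; rewrite gt_eqF.
rewrite ge0_integral_fold; last 2 first.
- apply: continuous_measurable_fun => u.
  apply: continuous_comp; last exact: continuous_matern_density.
  by apply: continuousD; [exact: cvg_id|exact: cvg_cst].
- by move=> u; exact: matern_density_ge0.
rewrite (_ : (fun u => (matern_density nu r (u + ln (r / 2)) +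
    matern_density nu r (- u + ln (r / 2)))%:E) = fun u =>
    ((2 * (r / 2) `^ nu)%:E * (expR (- (r * cosh u)) * cosh (nu * u))%:E)%E); last first.
  apply/funext => u; rewrite !shift -EFinM; congr EFin.
  have -> : cosh (- u) = cosh u by rewrite /cosh opprK addrC.
  by rewrite !expRD (mulrN nu) [cosh (nu * u)]/cosh; field.
have cosh_ge0 x : 0 <= cosh x by rewrite /cosh divr_ge0// addr_ge0 ?expR_ge0.
have c0 : 0 < 2 * (r / 2) `^ nu by rewrite mulr_gt0// powR_gt0.
rewrite ge0_integralZl_EFin; last 4 first.
- exact: measurable_itv.
- by move=> u _; rewrite lee_fin mulr_ge0 ?expR_ge0 ?cosh_ge0.
- apply/measurable_EFinP; apply: measurable_funTS; apply: measurable_funM.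
    apply: measurableT_comp => //; apply: measurableT_comp => //.
    by apply: measurable_funM => //; exact: measurable_cosh.
  by apply: measurableT_comp; [exact: measurable_cosh|exact: measurable_funM].
- exact: ltW.
(* [fine] sends infinite values to 0, so the equality holds whether or not the integral is
   finite. *)
rewrite /besselK /Rintegral; case: (integral _ _ _) => [x||] /=.
- by [].
- by rewrite gt0_muley ?lte_fin//= mulr0.
- by rewrite gt0_muleNy ?lte_fin//= mulr0.
Qed.

Lemma Rintegral_ge_itv (f : R -> R) (t m : R) : 0 <= t -> 0 <= m ->
  mu.-integrable setT (EFin \o f) -> (forall u, 0 <= f u) ->
  (forall u, - t <= u <= 0 -> m <= f u) -> m * t <= \int[mu]_u f u.
Proof.
move=> t0 m0 fi f0 mf; have [mEf _] := integrableP _ _ _ fi.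
rewrite -lee_fin fineK ?integrable_fin_num//.
have mI : measurable (`[- t, 0]%classic : set (measurableTypeR R)).
  exact: measurable_itv.
have -> : (m * t)%:E = (\int[mu]_(u in `[(- t)%R, 0%R]) m%:E)%E.
  rewrite integral_cst//= lebesgue_measure_itv/= lte_fin.
  have [/eqP|t_neq0] := eqVneq t 0.
    by move=> /eqP ->; rewrite oppr0 ltxx mulr0 mule0.
  by rewrite oppr_lt0 lt0r t_neq0 t0/= opprK add0e -EFinM.
have fI : (\int[mu]_(u in `[(- t)%R, 0%R]) (f u)%:E <= \int[mu]_u (f u)%:E)%E.
  by apply: ge0_subset_integral => // u _; rewrite lee_fin.
apply: le_trans fI; apply: ge0_le_integral => //.
exact: measurable_funS mEf.
Qed.

Lemma matern_density0_ge u : - 1 <= u <= 0 ->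
  expR (- nu - 1) <= matern_density nu 0 u.
Proof.
move=> /andP[u1 u0]; rewrite /matern_density ler_expR expr0n/= !mul0r subr0.
have : expR u <= 1 by rewrite -expR0 ler_expR.
have : 0 <= nu * (u + 1) by apply: mulr_ge0; [exact: ltW|lra].
lra.
Qed.

Lemma Gamma_gt0 : 0 < Gamma nu.
Proof.
rewrite Gamma_mixture; apply: (@lt_le_trans _ _ (expR (- nu - 1) * 1)).
  by rewrite mulr1 expR_gt0.
apply: Rintegral_ge_itv => //.
- exact: integrable_matern_density.
- by move=> u; exact: matern_density_ge0.
- by move=> u; exact: matern_density0_ge.
Qed.

(** On the diagonal the mixture is [Gamma nu] itself. Off the diagonal, 2^(1 - nu) r^nu equals 2 (r
    / 2)^nu, the factor in [besselK_mixture]. *)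
Lemma matern_mixtureE d (sigma2 phi : R) (s s' : 'rV[R]_d) : 0 < phi ->
  matern sigma2 phi nu%:E s s' =
  sigma2 / Gamma nu * matern_mixture (phi * enorm (s - s')).
Proof.
move=> phi0; rewrite /matern.
have G0 : Gamma nu != 0 by rewrite gt_eqF// Gamma_gt0.
case: eqP => [->|/eqP ss'].
  have -> : enorm (s' - s') = 0.
    rewrite /enorm subrr big1 ?sqrtr0// => i _; rewrite big1// => j _.
    by rewrite mxE expr0n.
  by rewrite mulr0 -Gamma_mixture divfK.
have e0 : 0 < enorm (s - s').
  rewrite lt_neqAle sqrtr_ge0 andbT; apply: contra ss' => /eqP/esym e0.
  have := enorm_rV_sqr (s - s'); rewrite e0 expr0n/= => /esym d0.
  apply/eqP/rowP => a; apply/eqP; rewrite -subr_eq0.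
  have := coord_sqr_le_dotv (s - s') a; rewrite d0 => h.
  have : ((s - s') ord0 a) ^+ 2 == 0 by rewrite eq_le h sqr_ge0.
  by rewrite sqrf_eq0 !mxE.
have r0 : 0 < phi * enorm (s - s') by rewrite mulr_gt0.
rewrite besselK_mixture//; set r := phi * _ in r0 *.
have rr2 : r = 2 * (r / 2) by rewrite mulrC divfK.
have -> : r `^ nu = 2 `^ nu * (r / 2) `^ nu.
  by rewrite {1}rr2 powRM// ltW// divr_gt0.
have -> : 2 `^ (1 - nu) = 2 / 2 `^ nu :> R.
  by rewrite powRB ?powRr1// pnatr_eq0 implybT.
by field; rewrite G0 gt_eqF// powR_gt0.
Qed.

Lemma matern_density_gauss d (phi u : R) (s s' : 'rV[R]_d) :
  matern_density nu (phi * enorm (s - s')) u =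
  matern_density nu 0 u * gauss (phi ^+ 2 / 4 * expR (- u)) s s'.
Proof.
rewrite /matern_density /gauss -expRD; congr expR.
by rewrite expr0n/= !mul0r; ring.
Qed.

Lemma matern_density_kernelE d (phi u : R) n (s : 'I_n -> 'rV[R]_d) v :
  matern_density nu 0 u * kernel_form (gauss (phi ^+ 2 / 4 * expR (- u))) s v =
  \sum_i \sum_j v i * v j * matern_density nu (phi * enorm (s i - s j)) u.
Proof.
rewrite mulr_sumr; apply: eq_bigr => i _.
rewrite mulr_sumr; apply: eq_bigr => j _.
by rewrite matern_density_gauss; ring.
Qed.

Lemma integrable_matern_kernel d (phi : R) n (s : 'I_n -> 'rV[R]_d) v :
  mu.-integrable setT (EFin \o (fun u => matern_density nu 0 u *
    kernel_form (gauss (phi ^+ 2 / 4 * expR (- u))) s v)).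
Proof.
rewrite (funext (fun u => matern_density_kernelE phi u s v)).
apply: Rintegrable_sum => i; apply: Rintegrable_sum => j.
exact/RintegrableZl/integrable_matern_density.
Qed.

Lemma kernel_form_matern d (sigma2 phi : R) n (s : 'I_n -> 'rV[R]_d) v :
  0 < phi -> kernel_form (matern sigma2 phi nu%:E) s v =
  sigma2 / Gamma nu * \int[mu]_u (matern_density nu 0 u *
    kernel_form (gauss (phi ^+ 2 / 4 * expR (- u))) s v).
Proof.
move=> phi0; rewrite (funext (fun u => matern_density_kernelE phi u s v)).
have fi i j := integrable_matern_density (phi * enorm (s i - s j)).
rewrite Rintegral_sum => [|i]; last first.
  by apply: Rintegrable_sum => j; exact: RintegrableZl.
rewrite mulr_sumr; apply: eq_bigr => i _.
rewrite Rintegral_sum => [|j]; last exact: RintegrableZl.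
rewrite mulr_sumr; apply: eq_bigr => j _.
by rewrite RintegralZl// matern_mixtureE// /matern_mixture; ring.
Qed.

(** The part [[-t, 0]] of the mixture has decays between [a0] and [a0 * expR t <= a0 + e], with
    weight at least [expR (- nu - 1)] since [t <= 1]. The remaining part is nonnegative and is
    dropped. *)
Lemma matern_gauss_dominated d (sigma2 phi : R) : 0 < sigma2 -> 0 < phi ->
  gauss_dominated (@matern R d sigma2 phi nu%:E).
Proof.
move=> sigma2_gt0 phi0; pose a0 := phi ^+ 2 / 4.
have a0_gt0 : 0 < a0 by rewrite divr_gt0// exprn_gt0.
exists a0 => // e e0; pose t := Num.min 1 (ln (1 + e / a0)).
have ea0 : 0 < e / a0 by rewrite divr_gt0.
have t0 : 0 < t by rewrite lt_min ltr01 ln_gt0// ltrDl.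
have t1 : t <= 1 by rewrite ge_min lexx.
have te : expR t <= 1 + e / a0.
  by rewrite -(@lnK _ (1 + e / a0)) ?ler_expR ?ge_min ?lexx ?orbT// posrE addr_gt0.
pose C := sigma2 / Gamma nu * (expR (- nu - 1) * t).
have C0 : 0 < C by rewrite !mulr_gt0 ?invr_gt0 ?expR_gt0 ?Gamma_gt0.
exists C^-1; first by rewrite invr_gt0.
move=> n s v b bq; rewrite ler_pdivlMl//.
rewrite kernel_form_matern// /C -[leLHS]mulrA ler_pM2l ?divr_gt0 ?Gamma_gt0//.
have q_ge0 u : 0 <= matern_density nu 0 u *
    kernel_form (gauss (phi ^+ 2 / 4 * expR (- u))) s v.
  rewrite mulr_ge0 ?matern_density_ge0// kernel_form_gauss_ge0//.
  by rewrite mulr_ge0 ?expR_ge0// ltW.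
have [b0|b0] := leP 0 b; last first.
  apply: (@le_trans _ _ 0); last exact: Rintegral_ge0.
  by rewrite pmulr_rle0 ?ltW// mulr_gt0// expR_gt0.
rewrite mulrAC; apply: Rintegral_ge_itv => //.
- exact: ltW.
- by rewrite mulr_ge0// expR_ge0.
- exact: integrable_matern_kernel.
move=> u /andP[tu u0]; apply: ler_pM => //.
  by rewrite matern_density0_ge// u0 andbT (le_trans _ tu)// lerN2.
apply: bq; rewrite -/a0; apply/andP; split.
  by rewrite ler_peMr ?(ltW a0_gt0)// -expR0 ler_expR oppr_ge0.
have -> : a0 + e = a0 * (1 + e / a0) by field; rewrite gt_eqF.
rewrite ler_pM2l// (le_trans _ te)// ler_expR.
by rewrite -[leRHS]opprK lerN2.
Qed.

End matern_density.

Lemma sqexp_gauss_dominated (R : realType) d (sigma2 phi : R) :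
  0 < sigma2 -> 0 < phi -> gauss_dominated (@matern R d sigma2 phi +oo%E).
Proof.
move=> sigma2_gt0 phi0; exists phi => // e e0.
exists sigma2^-1; first by rewrite invr_gt0.
move=> n s v b bq; rewrite ler_pdivlMl//.
have -> : kernel_form (matern sigma2 phi +oo%E) s v =
    sigma2 * kernel_form (gauss phi) s v.
  rewrite mulr_sumr; apply: eq_bigr => i _.
  by rewrite mulr_sumr; apply: eq_bigr => j _; rewrite /matern /gauss; ring.
by rewrite ler_pM2l// bq// lexx lerDl ltW.
Qed.

Lemma matern_sym (R : realType) d (sigma2 phi : R) nu (s t : 'rV[R]_d) :
  matern sigma2 phi nu s t = matern sigma2 phi nu t s.
Proof.
have e : enorm (s - t) = enorm (t - s).
  rewrite /enorm; congr Num.sqrt; apply: eq_bigr => i _; apply: eq_bigr => j _.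
  by rewrite !mxE -sqrrN opprB.
case: nu => [nu||]; last reflexivity.
  by rewrite /matern e eq_sym.
by rewrite /matern e.
Qed.

Lemma matern_diag (R : realType) d (sigma2 phi : R) nu (s : 'rV[R]_d) :
  (0 < nu)%E -> matern sigma2 phi nu s s = sigma2.
Proof.
have e : enorm (s - s) = 0.
  rewrite /enorm big1 ?sqrtr0// => i _; rewrite big1// => j _.
  by rewrite !mxE subrr expr0n.
case: nu => [nu||] // _; first by rewrite /matern eqxx.
by rewrite /matern e expr0n/= mulr0 oppr0 expR0 mulr1.
Qed.

Lemma gauss_dominated_matern (R : realType) d (sigma2 phi : R) nu :
  0 < sigma2 -> 0 < phi -> (0 < nu)%E ->
  gauss_dominated (@matern R d sigma2 phi nu).
Proof.
case: nu => [nu||] // sigma2_gt0 phi0 nu0; last exact: sqexp_gauss_dominated.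
by apply: matern_gauss_dominated => //; rewrite -lte_fin.
Qed.

Section measurable_matern.
Context {R : realType} {dT : measure_display} {T : measurableType dT}.
Notation mu := (@lebesgue_measure R).

Lemma measurable_matern_mixture (nu : R) :
  measurable_fun [set: R] (matern_mixture nu).
Proof.
apply: measurableT_comp; first exact: fine_measurable.
pose F (x : R * measurableTypeR R) := (matern_density nu x.1 x.2)%:E.
apply: (@measurable_fun_fubini_tonelli_F _ _ _ _ _ mu F); last first.
  by move=> x; rewrite lee_fin expR_ge0.
apply/measurable_EFinP; apply: measurableT_comp => //.
apply: measurable_funB.
  apply: measurable_funB; first by apply: measurable_funM => //; exact: measurable_snd.
  by apply: measurableT_comp => //; exact: measurable_snd.
apply: measurable_funM.
  by apply: measurable_funM => //; apply: measurable_funX; exact: measurable_fst.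
by do 2 apply: measurableT_comp => //; exact: measurable_snd.
Qed.

Lemma measurable_enorm_sub m n (f g : T -> 'M[R]_(m, n)) :
  measurable_fun [set: T] f -> measurable_fun [set: T] g ->
  measurable_fun [set: T] (fun w => enorm (f w - g w)).
Proof.
move=> /measurable_fun_matrixP mf /measurable_fun_matrixP mg.
have msqrt : measurable_fun [set: R] (@Num.sqrt R).
  by apply: continuous_measurable_fun; exact: sqrt_continuous.
apply: (measurableT_comp msqrt).
apply: measurable_sum => i.
apply: measurable_sum => j.
apply: measurable_funX; under eq_fun do rewrite !mxE.
exact: measurable_funB.
Qed.

(** For finite [nu] the mixture is used, because its integrand is jointly measurable and it treats
    the diagonal and its complement by one formula. *)
Lemma measurable_matern d (sigma2 phi : R) (nu : \bar R) (f g : T -> 'rV[R]_d) :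
  0 < phi -> (0 < nu)%E ->
  measurable_fun [set: T] f -> measurable_fun [set: T] g ->
  measurable_fun [set: T] (fun w => matern sigma2 phi nu (f w) (g w)).
Proof.
move=> phi0 nu0 mf mg; have me := measurable_enorm_sub mf mg.
case: nu nu0 => [nu||//] nu0.
  under eq_fun do rewrite matern_mixtureE//.
  apply: measurable_funM => //.
  apply: measurableT_comp; first exact: measurable_matern_mixture.
  exact: measurable_funM.
rewrite /matern; apply: measurable_funM => //; apply: measurableT_comp => //.
apply: measurableT_comp => //; apply: measurable_funM => //.
exact: measurable_funX.
Qed.

End measurable_matern.

(** * Bilinear forms, positive semidefinite matrices and the inverse of [Sigma] *)

Definition bform (R : comPzRingType) n (A : 'M[R]_n) (x y : 'cV[R]_n) : R :=
  (x^T *m A *m y) ord0 ord0.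

Section bform.
Context {R : comPzRingType} {n : nat}.
Implicit Types (A B : 'M[R]_n) (x y z : 'cV[R]_n).

Lemma bformE A x y : bform A x y = \sum_i \sum_j x i ord0 * A i j * y j ord0.
Proof.
rewrite /bform mxE exchange_big; apply: eq_bigr => j _ /=.
rewrite mxE mulr_suml; apply: eq_bigr => i _.
by rewrite mxE.
Qed.

Lemma bformDl A x y z : bform A (x + y) z = bform A x z + bform A y z.
Proof. by rewrite /bform linearD/= !mulmxDl mxE. Qed.

Lemma bformDr A x y z : bform A x (y + z) = bform A x y + bform A x z.
Proof. by rewrite /bform mulmxDr mxE. Qed.

Lemma bformZl A k x y : bform A (k *: x) y = k * bform A x y.
Proof. by rewrite /bform linearZ/= -!scalemxAl mxE. Qed.

Lemma bformZr A k x y : bform A x (k *: y) = k * bform A x y.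
Proof. by rewrite /bform -!scalemxAr mxE. Qed.

Lemma bformDm A B x y : bform (A + B) x y = bform A x y + bform B x y.
Proof. by rewrite /bform mulmxDr mulmxDl mxE. Qed.

Lemma bform_suml m A (F : 'I_m -> 'cV[R]_n) y :
  bform A (\sum_i F i) y = \sum_i bform A (F i) y.
Proof. by rewrite /bform linear_sum/= !mulmx_suml summxE. Qed.

Lemma bform_sumr m A (F : 'I_m -> 'cV[R]_n) y :
  bform A y (\sum_i F i) = \sum_i bform A y (F i).
Proof. by rewrite /bform mulmx_sumr summxE. Qed.

Lemma bformC A x y : A^T = A -> bform A x y = bform A y x.
Proof.
move=> sA; rewrite /bform -[in LHS](trmxK (x^T *m A *m y)) mxE.
by rewrite !trmx_mul trmxK sA mulmxA.
Qed.

Lemma bform_mulr A B x y : bform A x (B *m y) = bform (A *m B) x y.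
Proof. by rewrite /bform !mulmxA. Qed.

Lemma bform1 x y : bform 1%:M x y = \sum_i x i ord0 * y i ord0.
Proof. by rewrite /bform mulmx1 mxE; apply: eq_bigr => i _; rewrite mxE. Qed.

Lemma bform_scalar k x y : bform k%:M x y = k * bform 1%:M x y.
Proof. by rewrite /bform mulmx1 mul_mx_scalar -scalemxAl mxE. Qed.

End bform.

Lemma mulmx_col_sum (R : comPzRingType) n p (X : 'M[R]_(n, p)) (b : 'cV[R]_p) :
  X *m b = \sum_j b j ord0 *: col j X.
Proof.
apply/colP => i; rewrite mxE summxE; apply: eq_bigr => j _.
by rewrite !mxE mulrC.
Qed.

Definition psdmx (R : numDomainType) n (A : 'M[R]_n) :=
  A^T = A /\ forall x, 0 <= bform A x x.

Section psd.
Context {R : rcfType} {n : nat}.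
Implicit Types (A : 'M[R]_n) (x y : 'cV[R]_n).

Lemma psdmx_cauchy A x y : psdmx A ->
  bform A x y ^+ 2 <= bform A x x * bform A y y.
Proof.
move=> [sA psd].
set a := bform A x x; set b := bform A x y; set c := bform A y y.
have q t : 0 <= a + 2 * t * b + t ^+ 2 * c.
  have := psd (x + t *: y); rewrite bformDl !bformDr !bformZl !bformZr.
  by rewrite (bformC y x sA) -/a -/b -/c; nra.
have a0 : 0 <= a by exact: psd.
have c0 : 0 <= c by exact: psd.
have [c00|c_neq0] := eqVneq c 0.
  suff -> : b = 0 by rewrite expr0n mulr_ge0.
  apply/eqP/negP => /negP b0.
  (* At this point the polynomial, affine because [c = 0], would take the value -1. *)
  have := q (- (a + 1) / (2 * b)); rewrite c00 mulr0 addr0.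
  have -> : 2 * (- (a + 1) / (2 * b)) * b = - (a + 1) by field.
  lra.
have c_gt0 : 0 < c by rewrite lt0r c_neq0.
have := q (- b / c); rewrite -(pmulr_lge0 _ c_gt0).
have -> : (a + 2 * (- b / c) * b + (- b / c) ^+ 2 * c) * c = a * c - b ^+ 2.
  by field.
by rewrite subr_ge0.
Qed.

Lemma psdmx_bform_young A x y t : psdmx A -> 0 < t ->
  2 * bform A x y <= t * bform A x x + t^-1 * bform A y y.
Proof.
move=> [sA psd] t0; have := psd (t *: x - y).
rewrite bformDl !bformDr -scaleN1r !bformZl !bformZr (bformC y x sA).
set a := bform A x x; set b := bform A x y; set c := bform A y y => h.
have : 0 <= t^-1 * (t * (t * a) + t * (-1 * b) + (-1 * (t * b) + -1 * (-1 * c))).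
  by rewrite mulr_ge0// ?invr_ge0 ltW.
have -> : t^-1 * (t * (t * a) + t * (-1 * b) + (-1 * (t * b) + -1 * (-1 * c))) =
    t * a - 2 * b + t^-1 * c by field; rewrite gt_eqF.
lra.
Qed.

(** Lagrange's identity: twice the difference of the two sides is the sum over [j] and [k] of the
    forms of [c j *: x k - c k *: x j]. *)
Lemma psdmx_mulmx_le A p (X : 'M[R]_(n, p)) (b : 'cV[R]_p) : psdmx A ->
  bform A (X *m b) (X *m b) <=
  (\sum_j b j ord0 ^+ 2) * \sum_j bform A (col j X) (col j X).
Proof.
move=> [sA psd]; rewrite mulmx_col_sum.
pose x j := col j X; pose c j := b j ord0.
have h : 0 <= \sum_j \sum_k bform A (c j *: x k - c k *: x j)
    (c j *: x k - c k *: x j).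
  by apply: sumr_ge0 => j _; apply: sumr_ge0 => k _; exact: psd.
suff e : \sum_j \sum_k bform A (c j *: x k - c k *: x j)
    (c j *: x k - c k *: x j) =
    2 * ((\sum_j c j ^+ 2) * (\sum_k bform A (x k) (x k)) -
      bform A (\sum_j c j *: x j) (\sum_j c j *: x j)).
  by move: h; rewrite e pmulr_rge0// subr_ge0.
have -> : bform A (\sum_j c j *: x j) (\sum_j c j *: x j) =
    \sum_j \sum_k c j * c k * bform A (x j) (x k).
  rewrite bform_suml; apply: eq_bigr => j _.
  rewrite bform_sumr; apply: eq_bigr => k _.
  by rewrite bformZl bformZr mulrA.
have e1 : (\sum_j c j ^+ 2) * (\sum_k bform A (x k) (x k)) =
    \sum_j \sum_k c j ^+ 2 * bform A (x k) (x k).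
  by rewrite mulr_suml; apply: eq_bigr => j _; rewrite mulr_sumr.
have e2 : (\sum_j c j ^+ 2) * (\sum_k bform A (x k) (x k)) =
    \sum_j \sum_k c k ^+ 2 * bform A (x j) (x j).
  by rewrite e1 exchange_big.
rewrite mulrBr mulr2n mulrDl !mul1r {1}e1 e2 -big_split mulr_sumr -sumrB.
apply: eq_bigr => j _ /=; rewrite -big_split mulr_sumr -sumrB.
apply: eq_bigr => k _ /=.
rewrite -scaleNr bformDl !bformDr !bformZl !bformZr (bformC (x k) (x j) sA).
ring.
Qed.

End psd.

Section regularized_inverse.
Context {R : rcfType} {n : nat}.
Variables (K : 'M[R]_n) (tau2 : R).
Hypotheses (K_psd : psdmx K) (tau2_gt0 : 0 < tau2).
Let Sigma := K + tau2%:M.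
Let P := invmx Sigma.
Implicit Types x y : 'cV[R]_n.

Lemma sqr_bform1 x : bform 1%:M x x = \sum_i x i ord0 ^+ 2.
Proof. by rewrite bform1; apply: eq_bigr => i _; rewrite expr2. Qed.

Lemma bform1_ge0 x : 0 <= bform 1%:M x x.
Proof. by rewrite sqr_bform1; apply: sumr_ge0 => i _; exact: sqr_ge0. Qed.

Lemma psdmx1 : psdmx (1%:M : 'M[R]_n).
Proof. by split; [rewrite trmx1|exact: bform1_ge0]. Qed.

Lemma bform_Sigma x y : bform Sigma x y = bform K x y + tau2 * bform 1%:M x y.
Proof. by rewrite bformDm bform_scalar. Qed.

Lemma Sigma_ge x : tau2 * bform 1%:M x x <= bform Sigma x x.
Proof. by rewrite bform_Sigma lerDr; exact: K_psd.2. Qed.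

Lemma Sigma_psd : psdmx Sigma.
Proof.
split; first by rewrite linearD/= tr_scalar_mx K_psd.1.
by move=> x; rewrite (le_trans _ (Sigma_ge x))// mulr_ge0 ?bform1_ge0// ltW.
Qed.

Lemma bform1_eq0 x : bform 1%:M x x <= 0 -> x = 0.
Proof.
move=> x0; apply/colP => i; rewrite mxE; apply/eqP; rewrite -sqrf_eq0 eq_le.
rewrite sqr_ge0 andbT (le_trans _ x0)// sqr_bform1 (bigD1 i)//= lerDl.
by apply: sumr_ge0 => j _; exact: sqr_ge0.
Qed.

Lemma Sigma_unit : Sigma \in unitmx.
Proof.
rewrite -row_free_unit; apply: inj_row_free => v vS.
apply: trmx_inj; rewrite trmx0; apply: bform1_eq0.
rewrite -(pmulr_rle0 _ tau2_gt0) (le_trans (Sigma_ge _))//.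
by rewrite /bform trmxK vS mul0mx mxE.
Qed.

Lemma Sigma_P : Sigma *m P = 1%:M.
Proof. exact: mulmxV Sigma_unit. Qed.

Lemma P_sym : P^T = P.
Proof. by rewrite /P trmx_inv Sigma_psd.1. Qed.

Lemma bform_P x y : bform P x y = bform Sigma (P *m x) (P *m y).
Proof.
rewrite bform_mulr Sigma_P /bform trmx_mul P_sym mulmx1.
by rewrite -mulmxA.
Qed.

Lemma bform_P1 x y : bform P x y = bform 1%:M (P *m x) y.
Proof. by rewrite /bform trmx_mul P_sym mulmx1. Qed.

Lemma P_psd : psdmx P.
Proof.
by split; [exact: P_sym|move=> x; rewrite bform_P; exact: Sigma_psd.2].
Qed.

(** The value of the concave function [2 * <v, x> - bform Sigma v v] at its maximizer. The two
    negative terms are there to cancel the right-hand side of [continuous_native_bound]. *)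
Lemma bform_P_dual x : let v := P *m x in
  bform P x x = 2 * bform 1%:M v x - bform K v v - tau2 * bform 1%:M v v.
Proof.
move=> v; have := bform_P x x; rewrite -/v bform_Sigma => e.
have := bform_P1 x x; rewrite -/v => e1.
by rewrite {1}(_ : bform P x x = 2 * bform P x x - bform P x x);
  [rewrite {1}e1 e; ring|ring].
Qed.

Lemma bform_P_le x : bform P x x <= bform 1%:M x x / tau2.
Proof.
rewrite bform_P_dual; set v := P *m x.
have := psdmx_bform_young v x psdmx1 tau2_gt0.
have := K_psd.2 v.
by rewrite [_ / tau2]mulrC; lra.
Qed.

Lemma sqr_P_le x : bform 1%:M (P *m x) (P *m x) <= bform 1%:M x x / tau2 ^+ 2.
Proof.
set v := P *m x.
have h1 : tau2 * bform 1%:M v v <= bform 1%:M x x / tau2.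
  apply: le_trans (bform_P_le x); rewrite bform_P; exact: Sigma_ge.
rewrite expr2 invfM mulrA ler_pdivlMr//.
by rewrite mulrC.
Qed.

Lemma Sigma_P_cauchy x y :
  bform 1%:M x y ^+ 2 <= bform Sigma x x * bform P y y.
Proof.
rewrite bform_P -[bform 1%:M x y](_ : bform Sigma x (P *m y) = _).
  exact: psdmx_cauchy Sigma_psd.
by rewrite bform_mulr Sigma_P.
Qed.

End regularized_inverse.

(** * Deterministic bound for the estimation error *)

Section gls_error.
Context {R : realType} {n p : nat}.
Variables (K : 'M[R]_n) (tau2 : R) (h eta : 'M[R]_(n, p)) (g e : 'cV[R]_n).
Variables (N c M kappa : R).
Let Sigma := K + tau2%:M.
Let P := invmx Sigma.
Let X := h + eta.
(** Cauchy-Schwarz gives the form of [eta *m b] the coefficient [c ^+ 2 / M], that is [4 * m]; the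
    factor 4 leaves room for the passage to [X *m b]. *)
Let m := c ^+ 2 / (4 * M).

Hypotheses (K_psd : psdmx K) (tau2_gt0 : 0 < tau2) (N_gt0 : 0 < N).
Hypotheses (c_gt0 : 0 < c) (M_gt0 : 0 < M).
Hypotheses (kappa_gt0 : 0 < kappa) (kappa_le1 : kappa <= 1).
Hypothesis kappa_m : kappa * (p%:R + 1) <= m / 2.
Hypothesis g_small : bform P g g <= kappa ^+ 2 * N.
Hypothesis h_small : forall j, bform P (col j h) (col j h) <= kappa ^+ 2 * N.
Hypothesis e_bounded : bform 1%:M e e <= M * N.
Hypothesis eta_e : forall j, `|bform P (col j eta) e| <= kappa * N.
Hypothesis eta_large : forall b : 'cV[R]_p,
  c * enorm b ^+ 2 * N <= bform 1%:M (eta *m b) (eta *m b).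
Hypothesis eta_bounded : \sum_j bform Sigma (col j eta) (col j eta) <= M * N.

Let P_psd : psdmx P := P_psd K_psd tau2_gt0.

Lemma enorm_cV_sqr (b : 'cV[R]_p) : enorm b ^+ 2 = \sum_j b j ord0 ^+ 2.
Proof. by rewrite enorm_sqr; apply: eq_bigr => j _; rewrite big_ord1. Qed.

Lemma eta_form_ge (b : 'cV[R]_p) :
  4 * m * enorm b ^+ 2 * N <= bform P (eta *m b) (eta *m b).
Proof.
have b0 : 0 <= enorm b ^+ 2 by exact: sqr_ge0.
have q0 : 0 <= bform P (eta *m b) (eta *m b) by exact: P_psd.2.
have [b_eq0|b_neq0] := eqVneq (enorm b ^+ 2) 0.
  by rewrite b_eq0 mulr0 mul0r.
have b_gt0 : 0 < enorm b ^+ 2 by rewrite lt0r b_neq0.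
have := Sigma_P_cauchy K_psd tau2_gt0 (eta *m b) (eta *m b).
rewrite -/Sigma -/P; set q := bform P _ _ in q0 *; set s := bform Sigma _ _ => h1.
have h2 : s <= enorm b ^+ 2 * (M * N).
  apply: le_trans (psdmx_mulmx_le eta b (Sigma_psd K_psd tau2_gt0)) _.
  by rewrite -enorm_cV_sqr ler_wpM2l.
have h3 : (c * enorm b ^+ 2 * N) ^+ 2 <= enorm b ^+ 2 * (M * N) * q.
  apply: le_trans (_ : s * q <= _); last by rewrite ler_wpM2r.
  apply: le_trans h1; rewrite lerXn2r// ?nnegrE.
    by rewrite mulr_ge0 ?(ltW N_gt0)// mulr_ge0// ltW.
  exact: bform1_ge0.
have bMN : 0 < enorm b ^+ 2 * (M * N) by rewrite mulr_gt0// mulr_gt0.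
rewrite -(ler_pM2l bMN) (le_trans _ h3)//.
rewrite le_eqVlt; apply/orP; left; apply/eqP.
by rewrite /m; field; rewrite gt_eqF.
Qed.

Lemma h_form_le (b : 'cV[R]_p) :
  bform P (h *m b) (h *m b) <= enorm b ^+ 2 * (p%:R * kappa ^+ 2 * N).
Proof.
apply: le_trans (psdmx_mulmx_le h b P_psd) _.
rewrite -enorm_cV_sqr ler_wpM2l ?sqr_ge0//.
rewrite -mulrA mulr_natl -[X in _ *+ X]card_ord -sumr_const.
exact: ler_sum.
Qed.

Let m_gt0 : 0 < m.
Proof. by rewrite /m divr_gt0 ?exprn_gt0// mulr_gt0. Qed.

Let pkappa : p%:R * kappa ^+ 2 <= m / 2.
Proof.
have kk : kappa ^+ 2 <= kappa by rewrite expr2 ger_pMr.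
apply: le_trans kappa_m; apply: (@le_trans _ _ (p%:R * kappa)).
  by rewrite ler_wpM2l.
by rewrite mulrC ler_pM2l// lerDl.
Qed.

(** The form of [eta *m b = X *m b - h *m b] is at most twice the sum of the forms of the two terms,
    and that of [h *m b] is at most [m / 2 * enorm b ^+ 2 * N]. *)
Lemma design_form_ge (b : 'cV[R]_p) :
  m * enorm b ^+ 2 * N <= bform P (X *m b) (X *m b).
Proof.
have h1 := eta_form_ge b; have h2 := h_form_le b.
have := psdmx_bform_young (X *m b) (h *m b) P_psd ltr01.
rewrite invr1 !mul1r => yng.
have ex : bform P (eta *m b) (eta *m b) = bform P (X *m b) (X *m b) -
    2 * bform P (X *m b) (h *m b) + bform P (h *m b) (h *m b).
  have -> : eta *m b = X *m b - h *m b by rewrite -mulmxBl addrC addKr.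
  rewrite -scaleN1r bformDl !bformDr !bformZl !bformZr.
  rewrite (bformC (h *m b) (X *m b) P_psd.1); ring.
have := psdmx_bform_young (X *m b) (- (h *m b)) P_psd ltr01.
rewrite -scaleN1r !bformZr !bformZl invr1 !mul1r mulN1r mulrN mulN1r mulN1r opprK => yn.
set B := enorm b ^+ 2 in h1 h2 *.
have B0 : 0 <= B * N by rewrite mulr_ge0 ?sqr_ge0// ltW.
have : B * N * (p%:R * kappa ^+ 2) <= B * N * (m / 2) by rewrite ler_wpM2l.
nra.
Qed.

Lemma normal_matrix_unit : X^T *m P *m X \in unitmx.
Proof.
rewrite -row_free_unit; apply: inj_row_free => v vA.
apply: trmx_inj; rewrite trmx0.
have : bform P (X *m v^T) (X *m v^T) = 0.
  by rewrite /bform trmx_mul trmxK !mulmxA -(mulmxA v) -(mulmxA v) vA mul0mx mxE.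
have := design_form_ge v^T => + e0; rewrite e0.
rewrite -mulrA pmulr_rle0// pmulr_lle0// => b0.
apply/colP => j; rewrite [RHS]mxE; apply/eqP; rewrite -sqrf_eq0 eq_le.
rewrite sqr_ge0 andbT (le_trans _ b0)// enorm_cV_sqr (bigD1 j)//= lerDl.
by apply: sumr_ge0 => k _; exact: sqr_ge0.
Qed.

(** The normal equations express the form of [X *m b] by three pairings. The one with [g] absorbs a
    quarter of that form. The pairings of [h *m b] and [eta *m b] with [e] leave at most
    [kappa * (p%:R + 1) * enorm b ^+ 2 * N], absorbed through [kappa_m], and what remains is [kappa]
    times a constant. *)
Lemma gls_error (bstar : 'cV[R]_p) (Y : 'cV[R]_n) : Y = X *m bstar + g + e ->
  m * enorm (gls Sigma X Y - bstar) ^+ 2 <= 2 * kappa * (1 + p%:R + M / tau2).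
Proof.
move=> Y_def; set b := gls Sigma X Y - bstar.
have Ab : X^T *m P *m X *m b = X^T *m P *m (g + e).
  rewrite /b mulmxBr /gls -/P !mulmxA mulmxV ?normal_matrix_unit// mul1mx.
  by rewrite Y_def -addrA mulmxDr -!mulmxA addrAC subrr add0r.
have eb : bform P (X *m b) (X *m b) =
    bform P (X *m b) g + bform P (h *m b) e + bform P (eta *m b) e.
  rewrite -addrA -bformDl -mulmxDl -/X -bformDr.
  rewrite /bform trmx_mul -!mulmxA; congr ((_ *m _) _ _).
  by rewrite !mulmxA.
have N0 := ltW N_gt0.
have half_gt0 : 0 < 2^-1 :> R by rewrite invr_gt0.
have := psdmx_bform_young (X *m b) g P_psd half_gt0; rewrite invrK => q1.
(* The weight [kappa] balances the form of [h *m b], of order [kappa ^+ 2], against that of [e],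
   which is only bounded: both end up of order [kappa]. *)
have := psdmx_bform_young (e) (h *m b) P_psd kappa_gt0.
rewrite (bformC e (h *m b) P_psd.1) => q2.
have e_le : bform P e e <= M / tau2 * N.
  apply: le_trans (bform_P_le K_psd tau2_gt0 e) _.
  by rewrite mulrAC ler_pM2r// invr_gt0.
have q2' : kappa^-1 * bform P (h *m b) (h *m b) <= enorm b ^+ 2 * p%:R * kappa * N.
  rewrite ler_pdivrMl//; apply: le_trans (h_form_le b) _.
  by rewrite le_eqVlt; apply/orP; left; apply/eqP; ring.
have q2'' : kappa * bform P e e <= kappa * (M / tau2 * N) by rewrite ler_pM2l.
have q3 : 2 * bform P (eta *m b) e <= kappa * N * (p%:R + enorm b ^+ 2).
  rewrite mulmx_col_sum bform_suml mulr_sumr enorm_cV_sqr mulrDr mulr_sumr.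
  have -> : kappa * N * p%:R = \sum_(j < p) kappa * N.
    by rewrite sumr_const card_ord mulr_natr.
  rewrite -big_split; apply: ler_sum => j _ /=; rewrite bformZl.
  have := eta_e j; set t := bform P _ e; set x := b j ord0 => tk.
  have k0 : 0 <= kappa * N by rewrite mulr_ge0// ltW.
  apply: (@le_trans _ _ (2 * `|x| * (kappa * N))).
    rewrite -mulrA ler_pM2l// (le_trans (ler_norm _))// normrM.
    by rewrite ler_wpM2l.
  have : 0 <= kappa * N * (`|x| - 1) ^+ 2 by rewrite mulr_ge0// sqr_ge0.
  have := real_normK (num_real x); set y := `|x| => <-; nra.
have q4 := design_form_ge b; rewrite eb in q4.
have kk : kappa ^+ 2 * N <= kappa * N.
  by rewrite ler_pM2r// expr2 ger_pMr.
have km : enorm b ^+ 2 * N * (kappa * (p%:R + 1)) <= enorm b ^+ 2 * N * (m / 2).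
  by rewrite ler_wpM2l// mulr_ge0// sqr_ge0.
have g' := g_small.
rewrite -(ler_pM2r N_gt0); move: q1 q2 q2' q2'' q3 q4 kk km g' e_le.
rewrite eb; set B := enorm b ^+ 2; set t := M / tau2.
set x1 := bform P (X *m b) g; set x2 := bform P (h *m b) e.
set x3 := bform P (eta *m b) e; set x4 := bform P g g; set x5 := bform P e e.
set x6 := kappa^-1 * _; set x7 := kappa ^+ 2 * N.
have kt : 0 <= kappa * t * N by rewrite !mulr_ge0 ?invr_ge0// ltW.
have kp : 0 <= kappa * p%:R * N by rewrite !mulr_ge0// ltW.
nra.
Qed.

End gls_error.

(** * Independence, second moments and a weak law of large numbers *)

Section independent_product.
Context d (T : measurableType d) (R : realType) (P : probability T R).
Implicit Types U V : T -> R.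

Definition indep_fun U V := forall A B : set R, measurable A -> measurable B ->
  P (U @^-1` A `&` V @^-1` B) = (P (U @^-1` A) * P (V @^-1` B))%E.

Section product.
Variables U V : T -> R.
Hypotheses (mU : measurable_fun [set: T] U) (mV : measurable_fun [set: T] V).
Hypothesis UV : indep_fun U V.

Let X : {RV P >-> R} := mfun_Sub (mem_set mU).
Let Y : {RV P >-> R} := mfun_Sub (mem_set mV).
Let mZ : measurable_fun [set: T] (fun w => (U w, V w)).
Proof. exact: measurable_fun_pair. Qed.
Let Z : {RV P >-> (R * R)%type} := mfun_Sub (mem_set mZ).

Let joint_distribution A : measurable A ->
  (distribution P X \x distribution P Y)%E A = distribution P Z A.
Proof.
by move=> mA; apply: product_measure_unique => // B C mB mC; exact: UV.
Qed.

Lemma ge0_integral_indep (f : R * R -> \bar R) : measurable_fun setT f ->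
  (forall z, (0 <= f z)%E) ->
  (\int[P]_w f (U w, V w) =
   \int[distribution P X]_x \int[distribution P Y]_y f (x, y))%E.
Proof.
move=> mf f0.
rewrite -[RHS](@fubini_tonelli1 _ _ _ _ _ (distribution P X)
  (distribution P Y) f)//.
rewrite -(ge0_integral_distribution Z)//.
by apply: eq_measure_integral => A mA _; exact/esym/joint_distribution.
Qed.

Let mMul : measurable_fun setT (fun z : R * R => (z.1 * z.2)%:E).
Proof.
apply/measurable_EFinP; apply: measurable_funM; first exact: measurable_fst.
exact: measurable_snd.
Qed.

Hypotheses (iU : P.-integrable setT (EFin \o U))
  (iV : P.-integrable setT (EFin \o V)).

Let finite_abs (W : T -> R) : P.-integrable setT (EFin \o W) ->
  exists2 m : R, 0 <= m & (\int[P]_w `|W w|%:E = m%:E)%E.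
Proof.
move=> /integrableP[_]; under eq_integral do rewrite /=.
move=> Wy; exists (fine (\int[P]_w `|W w|%:E)).
  by rewrite fine_ge0// integral_ge0.
by rewrite fineK// ge0_fin_numE// integral_ge0.
Qed.

Lemma integrable_indepM : P.-integrable setT (EFin \o (fun w => U w * V w)).
Proof.
apply/integrableP; split.
  by apply/measurable_EFinP; exact: measurable_funM.
have [a a0 Ua] := finite_abs iU; have [b b0 Vb] := finite_abs iV.
pose f (z : R * R) : \bar R := `|(z.1 * z.2)%:E|%E.
have mf : measurable_fun setT f by exact: measurableT_comp.
have -> := ge0_integral_indep mf (fun z => abse_ge0 _).
have mabs : measurable_fun [set: R] (fun y : R => `|y|%:E).
  by apply/measurable_EFinP; exact: normr_measurable.
rewrite (_ : (fun x => _) = fun x => (b%:E * `|x|%:E)%E); last first.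
  apply/funext => x /=.
  under eq_integral do rewrite /f/= normrM EFinM.
  rewrite ge0_integralZl_EFin//.
  rewrite muleC; congr (_ * _)%E.
  by rewrite (ge0_integral_distribution Y)// -?Vb//; exact: mabs.
rewrite ge0_integralZl_EFin//.
rewrite (ge0_integral_distribution X)//.
by rewrite [X in (_ * X)%E]Ua -EFinM ltry.
Qed.

Lemma Rintegral_indepM :
  \int[P]_w (U w * V w) = (\int[P]_w U w) * (\int[P]_w V w).
Proof.
have iZ : (distribution P Z).-integrable setT (fun z : R * R => (z.1 * z.2)%:E).
  by apply: integrable_pushforward => //; exact: integrable_indepM.
have mZm := measurable_int _ iZ.
have iXY : (distribution P X \x distribution P Y)%E.-integrable setT
    (fun z : R * R => (z.1 * z.2)%:E).
  apply/integrableP; split => //; have /integrableP[_] := iZ.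
  congr (_ < _)%E; apply: eq_measure_integral => A mA _.
  exact/esym/joint_distribution.
apply: EFin_inj; rewrite EFinM !fineK ?integrable_fin_num//; last first.
  exact: integrable_indepM.
rewrite -[LHS](@integral_distribution _ _ _ _ _ P Z _ mMul integrable_indepM).
have -> : (\int[distribution P Z]_z (z.1 * z.2)%:E =
    \int[distribution P X \x distribution P Y]_z (z.1 * z.2)%:E)%E.
  by apply: eq_measure_integral => A mA _; exact/esym/joint_distribution.
rewrite -integral12_prod_meas1// /fubini_F/=.
have mid : measurable_fun [set: R] (@EFin R) by exact: EFin_measurable.
have dY : (distribution P Y).-integrable setT (@EFin R).
  exact: integrable_pushforward.
have dX : (distribution P X).-integrable setT (@EFin R).
  exact: integrable_pushforward.
have <- := @integral_distribution _ _ _ _ _ P Y _ mid iV.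
have <- := @integral_distribution _ _ _ _ _ P X _ mid iU.
under eq_integral => x _.
  under eq_integral do rewrite EFinM.
  rewrite integralZl//.
  over.
rewrite -(fineK (integrable_fin_num _ dY))// integralZr//.
Qed.

End product.

End independent_product.

Section independent_sigma.
Context d (T : measurableType d) (R : realType) (P : probability T R).

Lemma lambda_system_indep (C : set T) : measurable C ->
  lambda_system setT [set A | measurable A /\ P (A `&` C) = (P A * P C)%E].
Proof.
move=> mC; have fP (X : set T) : measurable X -> exists x : R, P X = x%:E.
  by move=> mX; exists (fine (P X)); rewrite fineK// fin_num_measure.
have [c Pc] := fP _ mC.
split => //.
- by split=> //; rewrite setTI probability_setT mul1e.
- move=> A B BA [mA AC] [mB BC]; split; first exact: measurableD.
  have mBA : measurable (A `\` B) by exact: measurableD.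
  have mAC : measurable (A `&` C) by exact: measurableI.
  have : P A = (P (A `\` B) + P B)%E.
    by rewrite [LHS](measureDI P mA mB) (setIidr BA).
  have : P (A `&` C) = (P ((A `\` B) `&` C) + P (B `&` C))%E.
    rewrite [LHS](measureDI P mAC mB) setIAC (setIidr BA); congr (P _ + _)%E.
    by apply/seteqP; split => x [[]].
  rewrite BC AC Pc.
  have [x ->] := fP _ mA; have [y ->] := fP _ mB; have [z ->] := fP _ mBA.
  have [t ->] := fP _ (measurableI _ _ mBA mC).
  rewrite -!EFinM -!EFinD => -[e1] [e2]; congr EFin; rewrite e2 in e1; lra.
- move=> F ndF FC; have mF n : measurable (F n) by have [] := FC n.
  have mUF : measurable (\bigcup_n F n) by exact: bigcup_measurable.
  split => //.
  have h1 : P (F n) @[n --> \oo] --> P (\bigcup_n F n).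
    exact: nondecreasing_cvg_mu.
  have h2 : P (F n `&` C) @[n --> \oo] --> P (\bigcup_n F n `&` C).
    rewrite setI_bigcupl; apply: nondecreasing_cvg_mu.
    + by move=> n; exact: measurableI.
    + by apply: bigcup_measurable => n _; exact: measurableI.
    + by move=> n m nm; apply/subsetPset; apply: setSI; exact/subsetPset/ndF.
  apply: (cvg_unique (@ereal_hausdorff R) h2).
  rewrite (_ : (fun n => P (F n `&` C)) = fun n => (P (F n) * P C)%E); last first.
    by apply/funext => n; have [_] := FC n.
  by rewrite Pc; exact: cvgeZr.
Qed.

(* Sierpinski-Dynkin: independence of [F, G, H] is transferred to [F \/ G]
   and [H] through the pi-system of intersections. *)
Lemma indep_join (F G H : set (set T)) :
  setI_closed F -> setI_closed G -> F setT -> G setT ->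
  F `<=` measurable -> G `<=` measurable -> H `<=` measurable -> H setT ->
  (forall A B C, F A -> G B -> H C ->
    P (A `&` B `&` C) = (P A * P B * P C)%E) ->
  forall A C, (<<s F `|` G >>) A -> H C -> P (A `&` C) = (P A * P C)%E.
Proof.
move=> FI GI FT GT Fm Gm Hm HT indep A C FGA HC.
pose FG := [set X | exists2 A, F A & exists2 B, G B & X = A `&` B].
have FGA' : (<<s FG >>) A.
  move: A FGA; apply: smallest_sub; first exact: smallest_sigma_algebra.
  move=> X [FX|GX]; apply: sub_sigma_algebra.
    by exists X => //; exists setT => //; rewrite setIT.
  by exists setT => //; exists X => //; rewrite setTI.
suff sub : <<s FG >> `<=` [set A | measurable A /\ P (A `&` C) = (P A * P C)%E].
  by have [] := sub _ FGA'.
apply: lambda_system_subset => //.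
- move=> _ _ [A1 FA1 [B1 GB1 ->]] [A2 FA2 [B2 GB2 ->]].
  exists (A1 `&` A2); first exact: FI.
  by exists (B1 `&` B2); [exact: GI|rewrite setIACA].
- exact/lambda_system_indep/Hm.
- move=> _ [A1 FA1 [B1 GB1 ->]]; split.
    by apply: measurableI; [exact: Fm|exact: Gm].
  rewrite indep//; congr (_ * _)%E.
  (* The instance [C = setT] gives the independence of [A1] and [B1]. *)
  have := indep _ _ _ FA1 GB1 HT.
  by rewrite setIT probability_setT mule1.
Qed.

End independent_sigma.

Section square_integrable.
Context d (T : measurableType d) (R : realType) (P : probability T R).
Implicit Types X Y : T -> R.

Definition square_integrable X := measurable_fun [set: T] X /\
  P.-integrable setT (EFin \o (fun w => X w ^+ 2)).

Lemma le_Rintegrable X Y : measurable_fun [set: T] X ->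
  P.-integrable setT (EFin \o Y) -> (forall w, `|X w| <= Y w) ->
  P.-integrable setT (EFin \o X).
Proof.
move=> mX iY XY; apply: le_integrable iY => //; first exact/measurable_EFinP.
by move=> w _; rewrite /= lee_fin (le_trans (XY w))// ler_norm.
Qed.

Lemma RintegrableD X Y : P.-integrable setT (EFin \o X) ->
  P.-integrable setT (EFin \o Y) ->
  P.-integrable setT (EFin \o (fun w => X w + Y w)).
Proof. by move=> iX iY; exact: (integrableD measurableT iX iY). Qed.

Lemma Rintegrable_cst (c : R) : P.-integrable setT (EFin \o (fun=> c)).
Proof. exact: finite_measure_integrable_cst. Qed.

Lemma Rintegral_cst_prob (c : R) : \int[P]_w c = c.
Proof.
have P1 : fine (P setT) = 1 by rewrite probability_setT.
by rewrite Rintegral_cst// [X in c * X]P1 mulr1.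
Qed.

Lemma bounded_Rintegrable X (c : R) : measurable_fun [set: T] X ->
  (forall w, `|X w| <= c) -> P.-integrable setT (EFin \o X).
Proof. by move=> mX; apply: le_Rintegrable => //; exact: Rintegrable_cst. Qed.

Lemma square_integrableM X Y : square_integrable X -> square_integrable Y ->
  P.-integrable setT (EFin \o (fun w => X w * Y w)).
Proof.
move=> [mX iX] [mY iY]; apply: le_Rintegrable (RintegrableD iX iY) _ => [|w].
  exact: measurable_funM.
rewrite normrM -(real_normK (num_real (X w))) -(real_normK (num_real (Y w))).
have := sqr_ge0 (`|X w| - `|Y w|).
have := normr_ge0 (X w); have := normr_ge0 (Y w).
set x := `|X w|; set y := `|Y w|; nra.
Qed.

Lemma square_integrable_integrable X : square_integrable X ->
  P.-integrable setT (EFin \o X).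
Proof.
move=> [mX iX]; apply: le_Rintegrable (RintegrableD (Rintegrable_cst 1) iX) _ => // w.
rewrite -(real_normK (num_real (X w))).
by have := sqr_ge0 (`|X w| - 1); set x := `|X w|; nra.
Qed.

Lemma covariance_centered X Y : ('E_P[X] = 0)%E -> ('E_P[Y] = 0)%E ->
  covariance P X Y = (\int[P]_w (X w * Y w)%:E)%E.
Proof.
move=> EX EY; rewrite covariance.unlock EX EY expectation.unlock.
by apply: eq_integral => w _; rewrite /= !fctE/= !subr0.
Qed.

Lemma variance_square_integrable X : measurable_fun [set: T] X ->
  ('E_P[X] = 0)%E -> ('V_P[X] < +oo)%E -> square_integrable X.
Proof.
move=> mX EX VX; split => //; apply/integrableP; split.
  by apply/measurable_EFinP; exact: measurable_funX.
move: VX; rewrite /variance covariance_centered//; apply: le_lt_trans.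
rewrite le_eqVlt; apply/orP; left; apply/eqP/eq_integral => w _ /=.
by rewrite ger0_norm ?sqr_ge0// expr2.
Qed.

Lemma Rintegral_centered X : ('E_P[X] = 0)%E -> \int[P]_w X w = 0.
Proof. by rewrite expectation.unlock /Rintegral => ->. Qed.

(** Lets the weak law be the case of constant coefficients in [expectation_quadratic_form]. *)
Lemma indep_fun_cst (c : R) Y : indep_fun P (fun=> c) Y.
Proof.
move=> A B mA mB; have [cA|ncA] := pselect (A c).
  have -> : (fun _ : T => c) @^-1` A = setT by apply/seteqP; split.
  by rewrite setTI probability_setT mul1e.
have -> : (fun _ : T => c) @^-1` A = set0 by apply/seteqP; split.
by rewrite set0I measure0 mul0e.
Qed.

(* For a pairwise uncorrelated family [V], only the diagonal of the quadratic
   form with independent coefficients [U] survives. *)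
Lemma expectation_quadratic_form n (U : 'I_n -> 'I_n -> T -> R)
    (V : 'I_n -> T -> R) (v : R) :
  (forall i j, measurable_fun [set: T] (U i j)) ->
  (forall i j, P.-integrable setT (EFin \o U i j)) ->
  (forall i, square_integrable (V i)) ->
  (forall i j, indep_fun P (U i j) (fun w => V i w * V j w)) ->
  (forall i j, i != j -> \int[P]_w (V i w * V j w) = 0) ->
  (forall i, \int[P]_w (V i w * V i w) = v) ->
  P.-integrable setT
    (EFin \o (fun w => \sum_i \sum_j U i j w * (V i w * V j w))) /\
  \int[P]_w (\sum_i \sum_j U i j w * (V i w * V j w)) =
    v * \sum_i \int[P]_w U i i w.
Proof.
move=> mU iU sV UV V0 Vv.
have mVV i j : measurable_fun [set: T] (fun w => V i w * V j w).
  by apply: measurable_funM; [exact: (sV i).1|exact: (sV j).1].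
have iVV i j := square_integrableM (sV i) (sV j).
have iUV i j : P.-integrable setT (EFin \o (fun w => U i j w * (V i w * V j w))).
  exact: integrable_indepM.
have iS i : P.-integrable setT
    (EFin \o (fun w => \sum_j U i j w * (V i w * V j w))).
  exact: Rintegrable_sum.
split; first exact: Rintegrable_sum.
rewrite Rintegral_sum// mulr_sumr; apply: eq_bigr => i _.
rewrite Rintegral_sum// (bigD1 i)//= big1 ?addr0 => [|j ji].
  by rewrite Rintegral_indepM// Vv mulrC.
by rewrite Rintegral_indepM// V0 ?mulr0// eq_sym.
Qed.

Lemma measurable_gt X (a : R) : measurable_fun [set: T] X ->
  measurable [set w | a < X w].
Proof.
move=> mX; rewrite (_ : [set w | a < X w] = X @^-1` `]a, +oo[%classic).
  by rewrite -[_ @^-1` _]setTI; apply: mX => //; exact: measurable_itv.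
by apply/seteqP; split => w; rewrite /= in_itv/= andbT.
Qed.

Lemma markov_Rintegral X (a : R) : measurable_fun [set: T] X ->
  P.-integrable setT (EFin \o X) -> (forall w, 0 <= X w) -> 0 < a ->
  (P [set w | (a < X w)%R] <= (\int[P]_w X w / a)%:E)%E.
Proof.
move=> mX iX X0 a0; have mA := measurable_gt a mX.
set A := [set w | _] in mA *.
rewrite EFinM fineK ?integrable_fin_num// lee_pdivlMr// muleC.
rewrite -[leLHS](integral_cst P mA a%:E).
have AX : (\int[P]_(w in A) (X w)%:E <= \int[P]_w (X w)%:E)%E.
  apply: ge0_subset_integral => //; first exact/measurable_EFinP.
  by move=> w _; rewrite lee_fin.
apply: le_trans AX; apply: ge0_le_integral => //.
- by move=> w _; rewrite lee_fin ltW.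
- exact/measurable_EFinP/measurable_funTS.
- by move=> w /ltW; rewrite lee_fin.
Qed.

End square_integrable.

Section iid_family.
Context d (T : measurableType d) (R : realType) (P : probability T R).
Context d' (T' : measurableType d') (X : nat -> {RV P >-> T'}).
Hypothesis X_iid : iid X.

Lemma iid_indep_fun (f g : T' -> R) i k : measurable_fun [set: T'] f ->
  measurable_fun [set: T'] g -> i != k ->
  indep_fun P (fun w => f (X i w)) (fun w => g (X k w)).
Proof.
move=> mf mg ik A B mA mB.
pose C (l : nat) := if l == i then (fun w => f (X i w)) @^-1` A
                    else (fun w => g (X k w)) @^-1` B.
have sys : forall l, l \in [:: i; k] ->
    preimage_set_system [set: T] (X l) measurable (C l).
  move=> l; rewrite !inE /C => /orP[/eqP ->|/eqP ->].
    rewrite eqxx; exists (f @^-1` A); last by rewrite setTI.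
    by rewrite -[_ @^-1` _]setTI; exact: mf.
  rewrite eq_sym (negbTE ik); exists (g @^-1` B); last by rewrite setTI.
  by rewrite -[_ @^-1` _]setTI; exact: mg.
have uniq_ik : uniq [:: i; k] by rewrite /= inE ik.
have := X_iid.1 _ uniq_ik _ sys.
rewrite !big_cons big_nil mule1 {2 3}/C eqxx eq_sym (negbTE ik) => <-.
congr (P _); apply/seteqP; split => w /=.
  move=> [Aw Bw] l; rewrite /= !inE => /orP[/eqP ->|/eqP ->]; rewrite /C.
    by rewrite eqxx.
  by rewrite eq_sym (negbTE ik).
move=> h; split.
  by have := h i; rewrite /= !inE eqxx /C eqxx; apply.
have := h k; rewrite /= !inE eqxx orbT /C eq_sym (negbTE ik).
by apply.
Qed.

Lemma iid_ge0_integral (f : T' -> \bar R) i : measurable_fun [set: T'] f ->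
  (forall x, (0 <= f x)%E) ->
  (\int[P]_w f (X i w) = \int[P]_w f (X 0 w))%E.
Proof.
move=> mf f0.
rewrite -[LHS](ge0_integral_distribution (X i) mf f0).
rewrite -[RHS](ge0_integral_distribution (X 0) mf f0).
by apply: eq_measure_integral => A mA _; exact: X_iid.2.
Qed.

Lemma iid_integrable (f : T' -> R) i : measurable_fun [set: T'] f ->
  P.-integrable setT (EFin \o (fun w => f (X 0 w))) ->
  P.-integrable setT (EFin \o (fun w => f (X i w))).
Proof.
move=> mf /integrableP[_ fi]; apply/integrableP; split.
  by apply/measurable_EFinP; apply: measurableT_comp.
move: fi; rewrite /= (@iid_ge0_integral (fun x => `|f x|%:E) i)//.
by apply/measurable_EFinP; exact: measurableT_comp.
Qed.

Lemma iid_Rintegral (f : T' -> R) i : measurable_fun [set: T'] f ->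
  P.-integrable setT (EFin \o (fun w => f (X 0 w))) ->
  \int[P]_w f (X i w) = \int[P]_w f (X 0 w).
Proof.
move=> mf f0; have fi := iid_integrable i mf f0.
have mEf : measurable_fun [set: T'] (EFin \o f) by exact/measurable_EFinP.
rewrite /Rintegral; congr fine.
rewrite -[LHS](@integral_distribution _ _ _ _ _ P (X i) _ mEf fi).
rewrite -[RHS](@integral_distribution _ _ _ _ _ P (X 0) _ mEf f0).
by apply: eq_measure_integral => A mA _; exact: X_iid.2.
Qed.

(** Chebyshev's inequality: the square of the centered sum is the quadratic form with all
    coefficients 1, so its expectation is [n] times the variance [v]. *)
Lemma iid_weak_law (f : T' -> R) (c : R) : measurable_fun [set: T'] f ->
  (forall x, `|f x| <= c) -> exists2 v : R, 0 <= v &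
  forall (n : nat) (k : R), (0 < n)%N -> 0 < k ->
  (P [set w | (k * n%:R <
      `|\sum_(i < n) f (X i w) - n%:R * \int[P]_w f (X 0 w)|)%R] <=
   (v / (k ^+ 2 * n%:R))%:E)%E.
Proof.
move=> mf fc; set m := \int[P]_w _.
pose f' x := f x - m.
have mf' : measurable_fun [set: T'] f' by exact: measurable_funB.
have f'c x : `|f' x| <= c + `|m|.
  by rewrite (le_trans (ler_normB _ _))// lerD2r.
have mV i : measurable_fun [set: T] (fun w => f' (X i w)) by exact: measurableT_comp.
have sV i : square_integrable P (fun w => f' (X i w)).
  split => //; apply: (@bounded_Rintegrable _ _ _ _ _ ((c + `|m|) ^+ 2)).
    exact: measurable_funX.
  by move=> w; rewrite normrX lerXn2r// nnegrE (le_trans _ (f'c (X i w))).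
have fi i : P.-integrable setT (EFin \o (fun w => f (X i w))).
  by apply: (@bounded_Rintegrable _ _ _ _ _ c) => //; exact: measurableT_comp.
have V0 i : \int[P]_w f' (X i w) = 0.
  rewrite /f' RintegralB//; last exact: Rintegrable_cst.
  by rewrite Rintegral_cst_prob iid_Rintegral// subrr.
pose v := \int[P]_w (f' (X 0 w) * f' (X 0 w)).
exists v; first by apply: Rintegral_ge0 => w _; rewrite -expr2 sqr_ge0.
move=> n k n0 k0; have n0' : 0 < n%:R :> R by rewrite ltr0n.
pose U (i j : 'I_n) (w : T) : R := 1.
have Uind i j : indep_fun P (U i j) (fun w => f' (X i w) * f' (X j w)).
  exact: indep_fun_cst.
have V00 (i j : 'I_n) : i != j -> \int[P]_w (f' (X i w) * f' (X j w)) = 0.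
  move=> ij; rewrite Rintegral_indepM ?V0 ?mul0r//.
  - exact: iid_indep_fun.
  - exact: square_integrable_integrable.
  - exact: square_integrable_integrable.
have Vv (i : 'I_n) : \int[P]_w (f' (X i w) * f' (X i w)) = v.
  rewrite (@iid_Rintegral (fun x => f' x * f' x))//.
    exact: measurable_funM.
  exact: (square_integrableM (sV 0%N) (sV 0%N)).
have [iQ EQ] := expectation_quadratic_form (fun _ _ => measurable_cst _)
  (fun _ _ => Rintegrable_cst P 1) (fun i => sV i) Uind V00 Vv.
have QE w : \sum_(i < n) \sum_(j < n) U i j w * (f' (X i w) * f' (X j w)) =
    (\sum_(i < n) f (X i w) - n%:R * m) ^+ 2.
  have -> : \sum_(i < n) f (X i w) - n%:R * m = \sum_(i < n) f' (X i w).
    by rewrite sumrB sumr_const card_ord mulr_natl.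
  rewrite expr2 mulr_suml; apply: eq_bigr => i _.
  by rewrite mulr_sumr; apply: eq_bigr => j _; rewrite /U mul1r.
have -> : [set w | k * n%:R < `|\sum_(i < n) f (X i w) - n%:R * m|] =
    [set w | (k * n%:R) ^+ 2 <
       \sum_(i < n) \sum_(j < n) U i j w * (f' (X i w) * f' (X j w))].
  apply/seteqP; split => w /=; rewrite QE -(real_normK (num_real (_ - _)));
    by rewrite ltr_pXn2r// nnegrE// ltW// mulr_gt0.
apply: le_trans (markov_Rintegral _ iQ _ _) _.
- apply: measurable_sum => i; apply: measurable_sum => j.
  by apply: measurable_funM => //; exact: measurable_funM.
- by move=> w; rewrite QE sqr_ge0.
- by rewrite exprn_gt0// mulr_gt0.
rewrite lee_fin EQ.
have -> : \sum_(i < n) \int[P]_w U i i w = n%:R.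
  under eq_bigr do rewrite Rintegral_cst_prob.
  by rewrite sumr_const card_ord.
rewrite le_eqVlt; apply/orP; left; apply/eqP; field.
by rewrite !gt_eqF.
Qed.

End iid_family.

(** * Properties that hold with probability close to 1 *)

Section likely.
Context d (T : measurableType d) (R : realType) (P : probability T R).
Implicit Types (Q : nat -> T -> Prop) (dl : R).

(** Measurability is asked of the exceptional sets only, so that [Q n] may quantify over all vectors
    [b]; the bound on their probability is asymptotic. *)
Definition likely dl Q := exists bad : nat -> set T,
  [/\ forall n, measurable (bad n),
      \forall n \near \oo, (P (bad n) <= dl%:E)%E &
      forall n w, ~ bad n w -> Q n w].

Lemma likely_and dl1 dl2 Q1 Q2 : likely dl1 Q1 -> likely dl2 Q2 ->
  likely (dl1 + dl2) (fun n w => Q1 n w /\ Q2 n w).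
Proof.
move=> [B1 [m1 p1 q1]] [B2 [m2 p2 q2]].
exists (fun n => B1 n `|` B2 n); split.
- by move=> n; exact: measurableU.
- near=> n; apply: le_trans (measureU2 P (m1 n) (m2 n)) _.
  by rewrite EFinD; apply: leeD; near: n.
- move=> n w /not_orP[n1 n2]; split; [exact: q1|exact: q2].
Unshelve. all: by end_near. Qed.

Lemma likely_weaken dl Q Q' : likely dl Q -> (forall n w, Q n w -> Q' n w) ->
  likely dl Q'.
Proof. by move=> [B [m1 p1 q1]] QQ'; exists B; split => // n w /q1/QQ'. Qed.

Lemma likely_forall p (Q : 'I_p -> nat -> T -> Prop) :
  (forall j dl, 0 < dl -> likely dl (Q j)) ->
  forall dl, 0 < dl -> likely dl (fun n w => forall j, Q j n w).
Proof.
elim: p Q => [|p IH] Q lQ dl dl0.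
  exists (fun=> set0); split => //; last by move=> n w _ [].
  by near=> n; rewrite measure0 lee_fin ltW.
have dl20 : 0 < dl / 2 by rewrite divr_gt0.
have h1 := lQ ord0 _ dl20.
have h2 := IH _ (fun j dl => lQ (lift ord0 j) dl) _ dl20.
rewrite (splitr dl); apply: likely_weaken (likely_and h1 h2) _ => n w [q0 q1] j.
by case: (unliftP ord0 j) => [k|] ->.
Unshelve. all: by end_near. Qed.

(** [C + 1] keeps the threshold positive when [C = 0]. At [n = 0] the threshold is 0 and Markov's
    inequality says nothing, hence the guard [0 < n]. *)
Lemma likely_markov dl (X : nat -> T -> R) (C : R) : 0 < dl -> 0 <= C ->
  (forall n, measurable_fun [set: T] (X n)) ->
  (forall n, P.-integrable setT (EFin \o X n)) ->
  (forall n w, 0 <= X n w) ->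
  (forall n, \int[P]_w X n w <= C * n%:R) ->
  likely dl (fun n w => (0 < n)%N -> X n w <= (C + 1) / dl * n%:R).
Proof.
move=> dl0 C0 mX iX X0 EX.
have a0 : 0 < (C + 1) / dl by rewrite divr_gt0// ltr_wpDl.
exists (fun n => if (0 < n)%N then [set w | (C + 1) / dl * n%:R < X n w] else set0).
split.
- by move=> n; case: ifP => // _; exact: measurable_gt.
- near=> n; have n0 : (0 < n)%N by near: n; exact: nbhs_infty_gt.
  have n0' : 0 < n%:R :> R by rewrite ltr0n.
  have an0 : 0 < (C + 1) / dl * n%:R by exact: mulr_gt0.
  rewrite n0; apply: le_trans (markov_Rintegral (mX n) (iX n) (X0 n) an0) _.
  rewrite lee_fin ler_pdivrMr//; apply: le_trans (EX n) _.
  have -> : dl * ((C + 1) / dl * n%:R) = (C + 1) * n%:R by field; rewrite gt_eqF.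
  by rewrite ler_pM2r// lerDl.
- by move=> n w + n0; rewrite n0 => /negP; rewrite -leNgt.
Unshelve. all: by end_near. Qed.

Lemma likely_vanish dl (bad : nat -> set T) (v : R) (Q : nat -> T -> Prop) :
  0 < dl -> 0 <= v -> (forall n, measurable (bad n)) ->
  (forall n, (0 < n)%N -> (P (bad n) <= (v / n%:R)%:E)%E) ->
  (forall n w, ~ bad n w -> Q n w) -> likely dl Q.
Proof.
move=> dl0 v0 mb pb bQ; exists bad; split => //.
near=> n; have n0 : (0 < n)%N by near: n; exact: nbhs_infty_gt.
have n0' : 0 < n%:R :> R by rewrite ltr0n.
apply: le_trans (pb n n0) _; rewrite lee_fin ler_pdivrMr// mulrC.
rewrite -ler_pdivrMr//; apply: ltW; near: n; exact: nbhs_infty_gtr.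
Unshelve. all: by end_near. Qed.

End likely.

(** * Lower bound for the Gram matrix of [eta] *)

Section posdef.
Context {R : realType} {p : nat}.
Implicit Types (M C : 'M[R]_p) (b : 'cV[R]_p).

Lemma bform_abs_le M b :
  `|bform M b b| <= (\sum_i \sum_j `|M i j|) * bform 1%:M b b.
Proof.
rewrite bformE mulr_suml (le_trans (ler_norm_sum _ _ _))//; apply: ler_sum => i _.
rewrite mulr_suml (le_trans (ler_norm_sum _ _ _))//; apply: ler_sum => j _.
rewrite mulrAC normrM mulrC ler_wpM2l// sqr_bform1.
have hi k : b k ord0 ^+ 2 <= \sum_l b l ord0 ^+ 2.
  rewrite (bigD1 k)//= lerDl; apply: sumr_ge0 => l _; exact: sqr_ge0.
rewrite normrM; have := hi i; have := hi j.
rewrite -(real_normK (num_real (b i ord0))) -(real_normK (num_real (b j ord0))).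
have := normr_ge0 (b i ord0); have := normr_ge0 (b j ord0).
set x := `|b i ord0|; set y := `|b j ord0|; have := sqr_ge0 (x - y); nra.
Qed.

(** Cauchy-Schwarz gives [|b|^4 <= bform C b b * bform (invmx C) b b], and the last factor is at
    most [|b|^2] times the sum of the absolute values of the entries of [invmx C]. *)
Lemma posdef_bform_ge C : C^T = C -> posdef C ->
  exists2 c : R, 0 < c & forall b, c * bform 1%:M b b <= bform C b b.
Proof.
move=> sC pC.
have pCb b : b != 0 -> 0 < bform C b b.
  by move=> b0; have := pC b^T; rewrite trmxK trmx_eq0; apply.
have psC : psdmx C.
  split => // b; have [->|b0] := eqVneq b 0; last exact/ltW/pCb.
  by rewrite /bform mulmx0 mxE.
have uC : C \in unitmx.
  rewrite -row_free_unit; apply: inj_row_free => v vC; apply/eqP.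
  apply/negPn/negP => v0; have := pC v v0.
  by rewrite vC mul0mx mxE ltxx.
pose A := 1 + \sum_i \sum_j `|invmx C i j|.
have A0 : 0 < A.
  by rewrite ltr_pwDl// sumr_ge0// => i _; rewrite sumr_ge0.
exists A^-1; first by rewrite invr_gt0.
move=> b; rewrite ler_pdivrMl//.
have b0 := @bform1_ge0 R p b.
have [->|bb_neq0] := eqVneq (bform 1%:M b b) 0.
  by rewrite mulr_ge0 ?(ltW A0)//; exact: psC.2.
have bb0 : 0 < bform 1%:M b b by rewrite lt0r bb_neq0.
have h1 : bform 1%:M b b ^+ 2 <= bform C b b * bform (invmx C) b b.
  have -> : bform (invmx C) b b = bform C (invmx C *m b) (invmx C *m b).
    by rewrite bform_mulr mulmxV// /bform trmx_mul trmx_inv sC mulmx1.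
  have -> : bform 1%:M b b = bform C b (invmx C *m b).
    by rewrite bform_mulr mulmxV.
  exact: psdmx_cauchy.
have h2 : bform (invmx C) b b <= A * bform 1%:M b b.
  rewrite (le_trans (ler_norm _))// (le_trans (bform_abs_le _ _))//.
  by rewrite ler_pM2r// lerDr.
have := psC.2 b; set q := bform C b b in h1 * => q0.
rewrite -(ler_pM2r bb0) -expr2 (le_trans h1)// mulrAC [_ * q]mulrC.
by rewrite ler_wpM2l.
Qed.

End posdef.

Section eta_gram.
Context d (T : measurableType d) (R : realType) (P : probability T R).
Context (p : nat) (eta : nat -> {RV P >-> 'rV[R]_p}).
Hypothesis eta_iid : iid eta.
Hypothesis eta_mean : forall i j, ('E_P[fun w => eta i w ord0 j] = 0)%E.
Hypothesis eta_var : forall i j, ('V_P[fun w => eta i w ord0 j] < +oo)%E.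

Lemma measurable_eta i j : measurable_fun [set: T] (fun w => eta i w ord0 j).
Proof. exact: (measurableT_comp (measurable_coord ord0 j) (measurable_funP (eta i))). Qed.

Lemma eta_square_integrable i j : square_integrable P (fun w => eta i w ord0 j).
Proof. by apply: variance_square_integrable => //; exact: measurable_eta. Qed.

(** The cut-off is on the norm of the whole vector and not on each product: the matrix of truncated
    moments of [x] is then either [x^T x] or 0, so that truncation only lowers the Gram form. *)
Definition truncated_moment (m : nat) (j k : 'I_p) (x : 'rV[R]_p) : R :=
  if dotv x x <= m%:R then x ord0 j * x ord0 k else 0.

Lemma measurable_moment (j k : 'I_p) :
  measurable_fun [set: 'rV[R]_p] (fun x => x ord0 j * x ord0 k).
Proof. by apply: measurable_funM; exact: measurable_coord. Qed.

Lemma measurable_truncated_moment m j k :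
  measurable_fun [set: 'rV[R]_p] (truncated_moment m j k).
Proof.
apply: measurable_fun_ifT => //; last exact: measurable_moment.
apply: measurable_fun_ler => //.
by apply: measurable_sum => a; exact: measurable_moment.
Qed.

Lemma moment_le (x : 'rV[R]_p) j k : `|x ord0 j * x ord0 k| <= dotv x x.
Proof.
have := coord_sqr_le_dotv x j; have := coord_sqr_le_dotv x k.
rewrite normrM -(real_normK (num_real (x ord0 j))) -(real_normK (num_real (x ord0 k))).
have := normr_ge0 (x ord0 j); have := normr_ge0 (x ord0 k).
set a := `|x ord0 j|; set b := `|x ord0 k|; have := sqr_ge0 (a - b); nra.
Qed.

Lemma truncated_moment_le m j k x : `|truncated_moment m j k x| <= m%:R.
Proof.
rewrite /truncated_moment; case: ifP => [xm|_]; last by rewrite normr0.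
exact: le_trans (moment_le _ _ _) xm.
Qed.

Lemma integrable_moment i j k :
  P.-integrable setT (EFin \o (fun w => eta i w ord0 j * eta i w ord0 k)).
Proof. by apply: square_integrableM; exact: eta_square_integrable. Qed.

Lemma cvg_truncated_moment j k :
  \int[P]_w truncated_moment m j k (eta 0%N w) @[m --> \oo] -->
  \int[P]_w (eta 0%N w ord0 j * eta 0%N w ord0 k).
Proof.
apply: fine_cvg; rewrite fineK; last exact/integrable_fin_num/integrable_moment.
apply: (@dominated_cvg _ _ _ P setT measurableT _ _
  (fun w => `|(eta 0%N w ord0 j * eta 0%N w ord0 k)%:E|%E)) => //.
- move=> m; apply/measurable_EFinP; apply: measurableT_comp => //.
  exact: measurable_truncated_moment.
- move=> w _; apply: cvg_near_cst; near=> m; rewrite /truncated_moment ifT//.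
  by apply: ltW; near: m; exact: nbhs_infty_gtr.
- exact/integrable_abse/integrable_moment.
- move=> m w _; rewrite /= lee_fin /truncated_moment; case: ifP => // _.
  by rewrite normr0.
Unshelve. all: by end_near. Qed.

Let C : 'M[R]_p := covariance_mx P (eta 0%N).

Lemma covariance_mxE j k :
  C j k = \int[P]_w (eta 0%N w ord0 j * eta 0%N w ord0 k).
Proof. by rewrite mxE covariance_centered. Qed.

Definition eta_mx n w : 'M[R]_(n, p) := \matrix_(i < n) eta i w.

Hypothesis eta_posdef : posdef C.

(** Second moments need not have a variance, so Chebyshev's inequality is applied after truncation.
    Uniformity in [b] comes from controlling the finitely many entries of a matrix of fixed size. *)
Lemma eta_gram_likely : exists2 c : R, 0 < c & forall dl, 0 < dl ->
  likely P dl (fun n w => forall b : 'cV[R]_p,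
    c * bform 1%:M b b * n%:R <= bform 1%:M (eta_mx n w *m b) (eta_mx n w *m b)).
Proof.
have sC : C^T = C by apply/matrixP => j k; rewrite !mxE covarianceC.
have [c c0 Cc] := posdef_bform_ge sC eta_posdef.
exists (c / 2); first by rewrite divr_gt0.
move=> dl dl0.
(* Each of the [p ^ 2] entries will deviate by at most [2 * kap * n%:R], one [kap] for the
   truncation and one for the weak law; together they cost at most half of [c]. *)
pose kap := c / (4 * (p%:R ^+ 2 + 1)).
have pp : 0 < 4 * (p%:R ^+ 2 + 1) :> R by rewrite mulr_gt0// ltr_wpDl// sqr_ge0.
have kap0 : 0 < kap by rewrite divr_gt0.
pose mom m j k := \int[P]_w truncated_moment m j k (eta 0%N w).
have [m hm] : exists m, forall j k, `|mom m j k - C j k| <= kap.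
  have : \forall m \near \oo, forall j k, `|mom m j k - C j k| <= kap.
    apply: filter_forall => j; apply: filter_forall => k; rewrite covariance_mxE.
    have /cvgrPdist_le/(_ _ kap0) := @cvg_truncated_moment j k.
    by apply: filterS => m; rewrite distrC.
  case=> m _ hm; exists m; apply: (hm m); exact: leqnn.
have lj j k dl' : 0 < dl' -> likely P dl' (fun n w =>
    `|\sum_(i < n) truncated_moment m j k (eta i w) - n%:R * mom m j k| <= kap * n%:R).
  move=> dl'0.
  have [v v0 hv] := iid_weak_law eta_iid (measurable_truncated_moment m j k)
    (truncated_moment_le m j k).
  have mS n : measurable_fun [set: T] (fun w =>
      `|\sum_(i < n) truncated_moment m j k (eta i w) - n%:R * mom m j k|).
    apply: measurableT_comp => //; apply: measurable_funB => //.
    apply: measurable_sum => i; apply: measurableT_comp => //.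
    exact: measurable_truncated_moment.
  pose bad n := [set w | kap * n%:R <
      `|\sum_(i < n) truncated_moment m j k (eta i w) - n%:R * mom m j k|].
  apply: (@likely_vanish _ _ _ P _ bad (v / kap ^+ 2)) => //.
  - by rewrite divr_ge0// sqr_ge0.
  - by move=> n; exact: measurable_gt.
  - move=> n n0; apply: le_trans (hv n kap n0 kap0) _.
    by rewrite lee_fin invfM mulrA.
  - by move=> n w /negP; rewrite -leNgt.
apply: likely_weaken (likely_forall (fun j => likely_forall (lj j)) dl0) _.
move=> n w h b.
pose G : 'M[R]_p := \matrix_(j, k) \sum_(i < n) truncated_moment m j k (eta i w).
(* Vectors beyond the truncation level contribute 0 on the left and a square on the right. *)
have GE : bform G b b <= bform 1%:M (eta_mx n w *m b) (eta_mx n w *m b).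
  rewrite sqr_bform1 bformE.
  have -> : \sum_j \sum_k b j ord0 * G j k * b k ord0 = \sum_(i < n)
      \sum_j \sum_k b j ord0 * truncated_moment m j k (eta i w) * b k ord0.
    rewrite [RHS]exchange_big; apply: eq_bigr => j _ /=.
    rewrite [RHS]exchange_big; apply: eq_bigr => k _ /=.
    by rewrite mxE mulr_sumr mulr_suml.
  apply: ler_sum => i _; rewrite /truncated_moment.
  case: (dotv (eta i w) (eta i w) <= m%:R); last first.
    rewrite big1 ?sqr_ge0// => j _; rewrite big1// => k _.
    by rewrite mulr0 mul0r.
  rewrite le_eqVlt; apply/orP; left; apply/eqP.
  rewrite expr2 !mxE mulr_suml; apply: eq_bigr => j _.
  rewrite mulr_sumr; apply: eq_bigr => k _.
  by rewrite !mxE; ring.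
apply: le_trans GE.
pose D : 'M[R]_p := G - n%:R *: C.
have n0 : 0 <= n%:R :> R by [].
have Djk j k : `|D j k| <= 2 * kap * n%:R.
  rewrite /D [X in `|X|]mxE [X in _ + X]mxE [X in _ - X]mxE [G _ _]mxE.
  set s := \sum_(i < n) _.
  have -> : s - n%:R * C j k = (s - n%:R * mom m j k) + n%:R * (mom m j k - C j k).
    by ring.
  have -> : 2 * kap * n%:R = kap * n%:R + kap * n%:R by ring.
  rewrite (le_trans (ler_normD _ _))// lerD//; first exact: h.
  by rewrite normrM ger0_norm// mulrC ler_wpM2r.
have Dle : \sum_j \sum_k `|D j k| <= c / 2 * n%:R.
  apply: (@le_trans _ _ (\sum_(j < p) \sum_(k < p) (2 * kap * n%:R))).
    by apply: ler_sum => j _; apply: ler_sum => k _.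
  rewrite !sumr_const !card_ord -mulrnA -[leLHS]mulr_natr natrM.
  have e : c / 2 = 2 * kap * (p%:R ^+ 2 + 1).
    by rewrite /kap; field; rewrite gt_eqF// ltr_wpDl// sqr_ge0.
  rewrite e; have : 0 <= 2 * kap * n%:R by rewrite mulr_ge0// mulr_ge0// ltW.
  by rewrite expr2; lra.
have := bform_abs_le D b; have := @bform1_ge0 R p b; have := Cc b.
have -> : bform D b b = bform G b b - n%:R * bform C b b.
  rewrite /D bformDm; congr (_ + _).
  by rewrite /bform -scaleNr -scalemxAr -scalemxAl mxE mulNr.
set x := bform 1%:M b b => Cb x0; rewrite ler_norml => /andP[h1 _].
have : (\sum_i \sum_j `|D i j|) * x <= c / 2 * n%:R * x by rewrite ler_wpM2r.
have : n%:R * (c * x) <= n%:R * bform C b b by rewrite ler_wpM2l.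
lra.
Qed.

End eta_gram.

(** * The random errors against [Sigma] and its inverse *)

Section measurable_inverse.
Context d (T : measurableType d) (R : realType).

(** [x * (x ^+ 2)^-1] only inverts a nonnegative number, where the inverse is a real power, and it
    agrees with the convention that the inverse of 0 is 0. *)
Lemma measurable_invr : measurable_fun [set: R] (@GRing.inv R).
Proof.
rewrite (_ : @GRing.inv R = fun x => x * (x ^+ 2) `^ (-1)).
  apply: measurable_funM => //; apply: (measurableT_comp (measurable_powR _)).
  exact: measurable_funX.
apply/funext => x; rewrite powR_inv1 ?sqr_ge0//.
have [->|x0] := eqVneq x 0; first by rewrite invr0 mul0r.
by field.
Qed.

Lemma measurable_det n (A : T -> 'M[R]_n) :
  (forall i j, measurable_fun [set: T] (fun w => A w i j)) ->
  measurable_fun [set: T] (fun w => \det (A w)).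
Proof.
move=> mA; apply: measurable_sum => s; apply: measurable_funM => //.
by apply: measurable_prod => i _; exact: mA.
Qed.

Lemma measurable_invmx n (A : T -> 'M[R]_n) i j :
  (forall w, A w \in unitmx) ->
  (forall i j, measurable_fun [set: T] (fun w => A w i j)) ->
  measurable_fun [set: T] (fun w => invmx (A w) i j).
Proof.
move=> uA mA; under eq_fun do rewrite /invmx uA mxE mxE.
apply: measurable_funM.
  by apply: (measurableT_comp measurable_invr); exact: measurable_det.
apply: measurable_funM => //; apply: measurable_det => k l.
by under eq_fun do rewrite !mxE; exact: mA.
Qed.

End measurable_inverse.

(** Young's inequality on basis vectors, with both signs. It bounds every entry of [Sigma_mx] by its
    constant diagonal, whence integrability. *)
Lemma psdmx_entry_le (R : rcfType) n (A : 'M[R]_n) i j : psdmx A ->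
  `|A i j| <= (A i i + A j j) / 2.
Proof.
move=> psA; have E k l : A k l = bform A (delta_mx k 0) (delta_mx l 0).
  rewrite /bform trmx_delta -rowE -colE.
  by rewrite !mxE.
have h1 := psdmx_bform_young (delta_mx i 0) (delta_mx j 0) psA ltr01.
have h2 := psdmx_bform_young (- delta_mx i 0) (delta_mx j 0) psA ltr01.
move: h1 h2; rewrite -scaleN1r !bformZl !bformZr invr1 !mul1r -!E.
by rewrite ler_norml => h1 h2; apply/andP; split; lra.
Qed.

Section error_terms.
Context {R : realType} {d p : nat} {dO : measure_display}.
Context {Omega : measurableType dO} (P : probability Omega R).
Variables (S : nat -> {RV P >-> 'rV[R]_d}) (eps : nat -> {RV P >-> R}).
Variable eta : nat -> {RV P >-> 'rV[R]_p}.
Hypothesis eps_iid : iid eps.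
Hypothesis eps_mean : forall i, ('E_P[eps i] = 0)%E.
Hypothesis eps_var : forall i, ('V_P[eps i] < +oo)%E.
Hypothesis eta_iid : iid eta.
Hypothesis eta_mean : forall i j, ('E_P[fun w => eta i w ord0 j] = 0)%E.
Hypothesis eta_var : forall i j, ('V_P[fun w => eta i w ord0 j] < +oo)%E.
Hypothesis indep : forall A B C, sigma_process [set: nat] S A ->
  sigma_process [set: nat] eps B -> sigma_process [set: nat] eta C ->
  P (A `&` B `&` C) = (P A * P B * P C)%E.
Variables (sigma2 phi tau2 : R) (nu : \bar R).
Hypotheses (sigma2_gt0 : 0 < sigma2) (phi_gt0 : 0 < phi) (tau2_gt0 : 0 < tau2).
Hypothesis nu_gt0 : (0 < nu)%E.

Definition kernel_mx n w : 'M[R]_n :=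
  \matrix_(i < n, j < n) matern sigma2 phi nu (S i w) (S j w).

Definition Sigma_mx n w : 'M[R]_n := kernel_mx n w + tau2%:M.

Definition eps_col n w : 'cV[R]_n := \col_(i < n) eps i w.

Lemma bform_kernel_mx n w (v : 'cV[R]_n) : bform (kernel_mx n w) v v =
  kernel_form (matern sigma2 phi nu) (fun i : 'I_n => S i w) (fun i => v i ord0).
Proof.
rewrite bformE; apply: eq_bigr => i _; apply: eq_bigr => j _.
by rewrite mxE mulrAC.
Qed.

Lemma kernel_mx_psd n w : psdmx (kernel_mx n w).
Proof.
split; first by apply/matrixP => i j; rewrite !mxE matern_sym.
move=> v; rewrite bform_kernel_mx; apply: gauss_dominated_psd.
exact: gauss_dominated_matern.
Qed.

(** The sample space is given smaller sigma-algebras: [OSe] has the events of the locations and of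
    [eps], [Oeta] those of [eta]. Measurability for these structures is what [indep_OSe_Oeta]
    converts into independence. *)
Let GSe := sigma_process [set: nat] S `|` sigma_process [set: nat] eps.
Let OSe := g_sigma_algebraType GSe.
Let Oeta := g_sigma_algebraType
  (\bigcup_(i in [set: nat]) preimage_set_system [set: Omega] (eta i) measurable).

Lemma sigma_process_measurable d' (T' : measurableType d')
  (X : nat -> {RV P >-> T'}) : sigma_process [set: nat] X `<=` measurable.
Proof.
apply: smallest_sub; first exact: sigma_algebra_measurable.
move=> _ [i _ [A mA <-]]; exact: measurable_funP.
Qed.

Lemma sigma_processI d' (T' : measurableType d') (X : nat -> {RV P >-> T'}) :
  setI_closed (sigma_process [set: nat] X).
Proof.
pose T0 := g_sigma_algebraType
  (\bigcup_(i in [set: nat]) preimage_set_system [set: Omega] (X i) measurable).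
by move=> A B; exact: (@measurableI _ T0).
Qed.

Lemma sigma_processT d' (T' : measurableType d') (X : nat -> {RV P >-> T'}) :
  sigma_process [set: nat] X setT.
Proof.
pose T0 := g_sigma_algebraType
  (\bigcup_(i in [set: nat]) preimage_set_system [set: Omega] (X i) measurable).
exact: (@measurableT _ T0).
Qed.

Lemma indep_OSe_Oeta (U : OSe -> R) (V : Oeta -> R) :
  measurable_fun [set: OSe] U -> measurable_fun [set: Oeta] V ->
  indep_fun P U V.
Proof.
move=> mU mV A B mA mB.
apply: (@indep_join _ _ _ P (sigma_process [set: nat] S)
  (sigma_process [set: nat] eps) (sigma_process [set: nat] eta)) => //;
  try exact: sigma_processI; try exact: sigma_processT;
  try exact: sigma_process_measurable.
- by have := mU measurableT A mA; rewrite setTI.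
- by have := mV measurableT B mB; rewrite setTI.
Qed.

Lemma measurable_OSe (U : OSe -> R) : measurable_fun [set: OSe] U ->
  measurable_fun [set: Omega] (U : Omega -> R).
Proof.
move=> mU _ A mA; have := mU measurableT A mA; apply: smallest_sub.
  exact: sigma_algebra_measurable.
by move=> X [|]; exact: sigma_process_measurable.
Qed.

Lemma measurable_S_OSe i : measurable_fun [set: OSe] (S i : OSe -> 'rV[R]_d).
Proof.
move=> _ A mA; apply: sub_sigma_algebra; left; apply: sub_sigma_algebra.
by exists i => //; exists A.
Qed.

Lemma measurable_eps_OSe i : measurable_fun [set: OSe] (eps i : OSe -> R).
Proof.
move=> _ A mA; apply: sub_sigma_algebra; right; apply: sub_sigma_algebra.
by exists i => //; exists A.
Qed.

Lemma measurable_eta_Oeta i j :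
  measurable_fun [set: Oeta] (fun w : Oeta => eta i w ord0 j).
Proof.
apply: (measurableT_comp (measurable_coord ord0 j)).
by move=> _ A mA; apply: sub_sigma_algebra; exists i => //; exists A.
Qed.

Lemma measurable_Sigma_OSe n i j :
  measurable_fun [set: OSe] (fun w : OSe => Sigma_mx n w i j).
Proof.
under eq_fun do rewrite !mxE; apply: measurable_funD => //.
by apply: measurable_matern => //; exact: measurable_S_OSe.
Qed.

Let eps_sq i : square_integrable P (eps i).
Proof. exact: variance_square_integrable. Qed.

Let eta_sq i j : square_integrable P (fun w => eta i w ord0 j).
Proof. exact: eta_square_integrable. Qed.

Let var_eps := \int[P]_w (eps 0%N w ^+ 2).

Let var_eps_ge0 : 0 <= var_eps.
Proof. by apply: Rintegral_ge0 => w _; exact: sqr_ge0. Qed.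

Let var_eta j := \int[P]_w (eta 0%N w ord0 j * eta 0%N w ord0 j).

Let var_eta_ge0 j : 0 <= var_eta j.
Proof. by apply: Rintegral_ge0 => w _; rewrite -expr2 sqr_ge0. Qed.

Lemma eps_col_sqr n w :
  bform 1%:M (eps_col n w) (eps_col n w) = \sum_(i < n) eps i w ^+ 2.
Proof. by rewrite sqr_bform1; apply: eq_bigr => i _; rewrite mxE. Qed.

Lemma integrable_eps_col n : P.-integrable setT
  (EFin \o (fun w => \sum_(i < n) eps i w ^+ 2)).
Proof. by apply: Rintegrable_sum => i; exact: (eps_sq i).2. Qed.

Lemma Rintegral_eps_col n :
  \int[P]_w (\sum_(i < n) eps i w ^+ 2) = var_eps * n%:R.
Proof.
rewrite Rintegral_sum => [|i]; last exact: (eps_sq i).2.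
under eq_bigr => i _.
  rewrite (@iid_Rintegral _ _ _ _ _ _ _ eps_iid (fun x => x ^+ 2)); last 2 first.
  - exact: measurable_funX.
  - exact: (eps_sq 0%N).2.
  over.
by rewrite sumr_const card_ord mulr_natr.
Qed.

Lemma eps_likely dl : 0 < dl -> exists2 M : R, 0 < M &
  likely P dl (fun n w => (0 < n)%N ->
    bform 1%:M (eps_col n w) (eps_col n w) <= M * n%:R).
Proof.
move=> dl0; exists ((var_eps + 1) / dl); first by rewrite divr_gt0// ltr_wpDl.
apply: likely_weaken (@likely_markov _ _ _ P dl
  (fun n w => \sum_(i < n) eps i w ^+ 2) var_eps dl0 var_eps_ge0 _ _ _ _) _.
- by move=> n; apply: measurable_sum => i; apply: measurable_funX; exact: (eps_sq i).1.
- exact: integrable_eps_col.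
- by move=> n w; apply: sumr_ge0 => i _; exact: sqr_ge0.
- by move=> n; rewrite Rintegral_eps_col.
- by move=> n w h n0; rewrite eps_col_sqr; exact: h.
Qed.

Lemma eta_uncorrelated i k j : i != k ->
  \int[P]_w (eta i w ord0 j * eta k w ord0 j) = 0.
Proof.
move=> ik; rewrite Rintegral_indepM.
- by rewrite Rintegral_centered ?mul0r.
- exact: (eta_sq i j).1.
- exact: (eta_sq k j).1.
- exact: (iid_indep_fun eta_iid (measurable_coord ord0 j) (measurable_coord ord0 j)).
- exact: square_integrable_integrable.
- exact: square_integrable_integrable.
Qed.

Lemma eta_variance i j :
  \int[P]_w (eta i w ord0 j * eta i w ord0 j) = var_eta j.
Proof.
rewrite (@iid_Rintegral _ _ _ _ _ _ _ eta_iid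
  (fun x : 'rV[R]_p => x ord0 j * x ord0 j))//.
- exact: measurable_moment.
- exact: (square_integrableM (eta_sq 0%N j) (eta_sq 0%N j)).
Qed.

(** Replaces conditioning on the locations and [eps]: coefficients measurable for [OSe] are
    independent of the products of entries of [eta], whose off-diagonal expectations vanish. *)
Lemma eta_quadratic_form n j (U : 'I_n -> 'I_n -> OSe -> R) :
  (forall i k, measurable_fun [set: OSe] (U i k)) ->
  (forall i k, P.-integrable setT (EFin \o (U i k : Omega -> R))) ->
  P.-integrable setT (EFin \o (fun w : Omega => \sum_i \sum_k U i k w *
    (eta i w ord0 j * eta k w ord0 j))) /\
  \int[P]_w (\sum_i \sum_k U i k w * (eta i w ord0 j * eta k w ord0 j)) =
    var_eta j * \sum_i \int[P]_w U i i w.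
Proof.
move=> mU iU; apply: (@expectation_quadratic_form _ _ _ P n
  (fun i k => (U i k : Omega -> R)) (fun i w => eta i w ord0 j)) => //.
- by move=> i k; exact: measurable_OSe.
- by move=> i k; apply: indep_OSe_Oeta => //; apply: measurable_funM;
    exact: measurable_eta_Oeta.
- by move=> i k ik; exact: eta_uncorrelated.
- by move=> i; exact: eta_variance.
Qed.

Lemma Sigma_mx_psd n w : psdmx (Sigma_mx n w).
Proof. exact: Sigma_psd (kernel_mx_psd n w) tau2_gt0. Qed.

Lemma Sigma_mx_diag n w i : Sigma_mx n w i i = sigma2 + tau2.
Proof. by rewrite !mxE matern_diag// eqxx mulr1n. Qed.

Lemma integrable_Sigma n i k :
  P.-integrable setT (EFin \o (fun w => Sigma_mx n w i k)).
Proof.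
apply: (@bounded_Rintegrable _ _ _ _ _ (sigma2 + tau2)).
  exact: measurable_OSe (measurable_Sigma_OSe i k).
move=> w; apply: le_trans (psdmx_entry_le i k (Sigma_mx_psd n w)) _.
by rewrite !Sigma_mx_diag; lra.
Qed.

Lemma bform_eta_col n w A j : bform A (col j (eta_mx eta n w)) (col j (eta_mx eta n w)) =
  \sum_i \sum_k A i k * (eta i w ord0 j * eta k w ord0 j).
Proof.
rewrite bformE; apply: eq_bigr => i _; apply: eq_bigr => k _.
by rewrite !mxE; ring.
Qed.

Lemma eta_Sigma_likely dl : 0 < dl -> exists2 M : R, 0 < M &
  likely P dl (fun n w => (0 < n)%N ->
    \sum_j bform (Sigma_mx n w) (col j (eta_mx eta n w)) (col j (eta_mx eta n w))
      <= M * n%:R).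
Proof.
move=> dl0; pose c := (\sum_j var_eta j) * (sigma2 + tau2).
have c0 : 0 <= c.
  by rewrite mulr_ge0 ?addr_ge0 ?(ltW sigma2_gt0) ?(ltW tau2_gt0)// sumr_ge0.
pose Q n j (w : Omega) := \sum_(i < n) \sum_(k < n) Sigma_mx n w i k *
  (eta i w ord0 j * eta k w ord0 j).
have h n j := @eta_quadratic_form n j (fun i k w => Sigma_mx n w i k)
  (fun i k => measurable_Sigma_OSe i k) (fun i k => integrable_Sigma i k).
exists ((c + 1) / dl); first by rewrite divr_gt0// ltr_wpDl.
apply: likely_weaken (@likely_markov _ _ _ P dl
  (fun n w => \sum_j Q n j w) c dl0 c0 _ _ _ _) _.
- move=> n; apply: measurable_sum => j; apply: measurable_sum => i.
  apply: measurable_sum => k; apply: measurable_funM.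
    exact: measurable_OSe (measurable_Sigma_OSe i k).
  by apply: measurable_funM; exact: measurable_eta.
- by move=> n; apply: Rintegrable_sum => j; exact: (h n j).1.
- move=> n w; apply: sumr_ge0 => j _; rewrite /Q -bform_eta_col.
  exact: (Sigma_mx_psd n w).2.
- move=> n; rewrite Rintegral_sum => [|j]; last exact: (h n j).1.
  under eq_bigr => j _.
    rewrite (h n j).2; under eq_bigr => i _.
      under eq_Rintegral do rewrite Sigma_mx_diag.
      rewrite Rintegral_cst_prob; over.
    rewrite sumr_const card_ord -mulr_natr mulrA; over.
  by rewrite -!mulr_suml.
- move=> n w hn n0; rewrite (eq_bigr (fun j => Q n j w)); first exact: hn.
  by move=> j _; rewrite bform_eta_col.
Qed.

Let whitened n w : 'cV[R]_n := invmx (Sigma_mx n w) *m eps_col n w.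

Lemma measurable_whitened_OSe n i :
  measurable_fun [set: OSe] (fun w : OSe => whitened n w i ord0).
Proof.
under eq_fun do rewrite mxE; apply: measurable_sum => k.
apply: measurable_funM.
  apply: measurable_invmx => [w|i' j']; last exact: measurable_Sigma_OSe.
  exact: Sigma_unit (kernel_mx_psd n w) tau2_gt0.
by under eq_fun do rewrite mxE; exact: measurable_eps_OSe.
Qed.

Lemma whitened_sqr_le n w :
  \sum_i whitened n w i ord0 ^+ 2 <= (\sum_(i < n) eps i w ^+ 2) / tau2 ^+ 2.
Proof.
rewrite -sqr_bform1 -eps_col_sqr.
exact: sqr_P_le (kernel_mx_psd n w) tau2_gt0 _.
Qed.

Lemma whitened_square_integrable n i :
  square_integrable P (fun w => whitened n w i ord0).
Proof.
have mW := measurable_OSe (@measurable_whitened_OSe n i); split => //.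
have := RintegrableZl (tau2 ^+ 2)^-1 (integrable_eps_col n).
move=> /(le_Rintegrable (X := fun w => whitened n w i ord0 ^+ 2)); apply.
  exact: measurable_funX.
move=> w; rewrite ger0_norm ?sqr_ge0// mulrC; apply: le_trans (whitened_sqr_le n w).
by rewrite (bigD1 i)//= lerDl; apply: sumr_ge0 => k _; exact: sqr_ge0.
Qed.

Lemma cross_likely (kappa : R) j dl : 0 < kappa -> 0 < dl ->
  likely P dl (fun n w => (0 < n)%N ->
    `|bform (invmx (Sigma_mx n w)) (col j (eta_mx eta n w)) (eps_col n w)|
      <= kappa * n%:R).
Proof.
move=> kappa0 dl0.
(* The square of the cross term is a quadratic form in the [j]-th coordinates of [eta], with
   coefficients that depend on [S] and [eps] only. *)
pose U n (i k : 'I_n) (w : OSe) := whitened n w i ord0 * whitened n w k ord0.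
pose Q n (w : Omega) := \sum_(i < n) \sum_(k < n) U n i k w *
  (eta i w ord0 j * eta k w ord0 j).
have QE n w : Q n w =
    bform (invmx (Sigma_mx n w)) (col j (eta_mx eta n w)) (eps_col n w) ^+ 2.
  rewrite -[invmx _]mul1mx -bform_mulr bform1 -/(whitened n w) expr2 mulr_suml.
  apply: eq_bigr => i _; rewrite mulr_sumr; apply: eq_bigr => k _.
  by rewrite /U !mxE; ring.
have h n := @eta_quadratic_form n j (U n)
  (fun i k => measurable_funM (@measurable_whitened_OSe n i)
     (@measurable_whitened_OSe n k))
  (fun i k => square_integrableM (@whitened_square_integrable n i)
     (@whitened_square_integrable n k)).
have mQ n : measurable_fun [set: Omega] (Q n).
  apply: measurable_sum => i; apply: measurable_sum => k; apply: measurable_funM.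
    by apply: measurable_OSe; apply: measurable_funM; exact: measurable_whitened_OSe.
  by apply: measurable_funM; exact: measurable_eta.
have EQ n : \int[P]_w Q n w <= var_eta j * (var_eps / tau2 ^+ 2 * n%:R).
  rewrite (h n).2 ler_wpM2l//.
  rewrite -Rintegral_sum => [|i]; last first.
    exact: (square_integrableM (@whitened_square_integrable n i)
      (@whitened_square_integrable n i)).
  apply: (@le_trans _ _ (\int[P]_w ((tau2 ^+ 2)^-1 * \sum_(i < n) eps i w ^+ 2))).
    apply: le_Rintegral => //.
    - apply: Rintegrable_sum => i.
      exact: (square_integrableM (@whitened_square_integrable n i)
        (@whitened_square_integrable n i)).
    - exact/RintegrableZl/integrable_eps_col.
    - move=> w _; rewrite mulrC; apply: le_trans (whitened_sqr_le n w).
      by apply: ler_sum => i _; rewrite /U -expr2.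
  rewrite RintegralZl//; last exact: integrable_eps_col.
  by rewrite Rintegral_eps_col mulrA [_^-1 * _]mulrC.
pose bad n := [set w | (kappa * n%:R) ^+ 2 < Q n w].
pose v := var_eta j * (var_eps / tau2 ^+ 2) / kappa ^+ 2.
apply: (@likely_vanish _ _ _ P dl bad v) => //.
- by rewrite !mulr_ge0 ?invr_ge0 ?sqr_ge0.
- by move=> n; exact: measurable_gt.
- move=> n n0; have n0' : 0 < n%:R :> R by rewrite ltr0n.
  have Q0 w : 0 <= Q n w by rewrite QE sqr_ge0.
  have kn : 0 < (kappa * n%:R) ^+ 2 by rewrite exprn_gt0// mulr_gt0.
  apply: le_trans (markov_Rintegral (mQ n) (h n).1 Q0 kn) _.
  rewrite lee_fin ler_pdivrMr//; apply: le_trans (EQ n) _.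
  rewrite le_eqVlt; apply/orP; left; apply/eqP; rewrite /v; field.
  by rewrite !gt_eqF.
- move=> n w + n0; rewrite /bad/= QE => /negP; rewrite -leNgt => hQ.
  rewrite -(ler_pXn2r (n := 2))// ?nnegrE//.
    by rewrite real_normK ?num_real.
  by rewrite mulr_ge0// ltW.
Qed.

End error_terms.

(** * From pathwise bounds to convergence in probability *)

Section convergence.
Context d (T : measurableType d) (R : realType) (P : probability T R).

(** The limit superior of the sets is null, and the probabilities of the tail unions decrease to its
    probability. This removes the dependence of the rank on the path. *)
Lemma likely_ae dl (B : nat -> set T) : 0 < dl ->
  (forall n, measurable (B n)) ->
  {ae P, forall w, \forall n \near \oo, ~ B n w} ->
  \forall n \near \oo, (P (B n) <= dl%:E)%E.
Proof.
move=> dl0 mB [N [mN PN subN]].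
have mL : measurable (lim_sup_set B).
  apply: bigcap_measurable => // n _.
  by apply: bigcup_measurable => k _; exact: mB.
have L0 : P (lim_sup_set B) = 0%E.
  apply/eqP; rewrite -measure_le0 -PN; apply: le_measure; rewrite ?inE//.
  move=> w Lw; apply: subN => -[n _ nB].
  have [k /= nk Bk] := Lw n I.
  exact: nB nk Bk.
have h : (P (\bigcup_(k >= 0) B k) < +oo)%E.
  by rewrite (le_lt_trans (probability_le1 _ _)) ?ltry//; exact: bigcup_measurable.
have : P (\bigcup_(k >= n) B k) @[n --> \oo] --> 0%E.
  by rewrite -L0; exact: lim_sup_set_cvg.
move=> /fine_cvgP[_ /cvgrPdist_le/(_ _ dl0)].
apply: filterS => n; rewrite sub0r normrN => hn.
have mU : measurable (\bigcup_(k >= n) B k) by exact: bigcup_measurable.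
apply: (@le_trans _ _ (P (\bigcup_(k >= n) B k))).
  by apply: le_measure; rewrite ?inE//; apply: bigcup_sup => /=.
rewrite -[leLHS]fineK ?fin_num_measure// lee_fin.
exact: le_trans (ler_norm _) hn.
Qed.

Lemma cvg0_prob (B : nat -> set T) : (forall n, measurable (B n)) ->
  (forall dl : R, 0 < dl -> \forall n \near \oo, (P (B n) <= dl%:E)%E) ->
  P (B n) @[n --> \oo] --> 0%E.
Proof.
move=> mB h; apply/fine_cvgP; split.
  by apply: nearW => n; exact: fin_num_measure.
apply/cvgrPdist_le => dl dl0; apply: filterS (h _ dl0) => n hn.
rewrite sub0r normrN ger0_norm ?fine_ge0//.
by rewrite -lee_fin fineK// fin_num_measure.
Qed.

End convergence.

Lemma within_continuous_comp (X Y Z : topologicalType) (D : set X) (F : X -> Y)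
    (G : Y -> Z) : {within D, continuous F} -> continuous G ->
  {within D, continuous (G \o F)}.
Proof. by move=> cF cG x; exact: (@continuous_comp (subspace D) Y Z F G x (cF x) (cG _)). Qed.

(** With [t = tau2] and the weights [v] of [bform_P_dual], the bound of [continuous_native_bound]
    cancels the subtracted terms exactly; there remains [C + n%:R * (k / 2)], and [C] is eventually
    below the second term. *)
Lemma smooth_form_small (R : realType) d (K : 'rV[R]_d -> 'rV[R]_d -> R)
    (D : set 'rV[R]_d) (f : 'rV[R]_d -> R) (s : nat -> 'rV[R]_d) (tau2 k : R) :
  gauss_dominated K -> (forall x y, K x y = K y x) -> compact D ->
  {within D, continuous f} -> (forall i, D (s i)) -> 0 < tau2 -> 0 < k ->
  \forall n \near \oo,
    bform (invmx (\matrix_(i < n, j < n) K (s i) (s j) + tau2%:M))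
      (\col_(i < n) f (s i)) (\col_(i < n) f (s i)) <= k * n%:R.
Proof.
move=> domK symK cD cf Ds tau0 k0; have k20 : 0 < k / 2 by rewrite divr_gt0.
have [C hC] := continuous_native_bound domK cD cf tau0 k20.
near=> n => /=; set Kn := \matrix_(i, j) _; set fn := \col_i _.
have KnE v : bform Kn v v =
    kernel_form K (fun i : 'I_n => s i) (fun i => v i ord0).
  rewrite bformE; apply: eq_bigr => i _; apply: eq_bigr => j _.
  by rewrite mxE mulrAC.
have psK : psdmx Kn.
  split; first by apply/matrixP => i j; rewrite !mxE.
  by move=> v; rewrite KnE; exact: gauss_dominated_psd.
rewrite (bform_P_dual psK tau0); set v := invmx _ *m fn.
have := hC n (fun i => s i) (fun i => v i ord0) (fun i => Ds i).
rewrite -KnE -sqr_bform1.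
have -> : \sum_(i < n) v i ord0 * f (s i) = bform 1%:M v fn.
  by rewrite bform1; apply: eq_bigr => i _; rewrite [fn _ _]mxE.
have : C <= n%:R * (k / 2).
  rewrite -ler_pdivrMr//; apply: ltW; near: n; exact: nbhs_infty_gtr.
lra.
Unshelve. all: by end_near. Qed.

Theorem theorem2 (R : realType) (d p : nat) (d_gt0 : (0 < d)%N)
    (dO : measure_display) (Omega : measurableType dO) (P : probability Omega R)
    (* spatial domain *)
    (D : set 'rV[R]_d) (D_convex : convex_set D) (D_compact : compact D)
    (* locations *)
    (fs : 'rV[R]_d -> R)
    (fs_density : is_density fs) (fs_support : density_support fs = D)
    (S : nat -> {RV P >-> 'rV[R]_d})
    (S_in_D : forall i w, D (S i w))
    (S_iid : iid S) (S_density : forall i, has_density (S i) fs)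
    (* random functions *)
    (g : 'rV[R]_d -> Omega -> R) (h : 'rV[R]_d -> Omega -> 'rV[R]_p)
    (gh_measurable : forall s, D s ->
       measurable_fun [set: Omega] (fun w => (g s w, h s w)))
    (gh_continuous :
       {ae P, forall w, {within D, continuous (fun s => (g s w, h s w))}})
    (* errors: eps i = epsilon(S_i) and eta i = eta(S_i) *)
    (eps : nat -> {RV P >-> R}) (eta : nat -> {RV P >-> 'rV[R]_p})
    (eps_iid : iid eps)
    (eps_mean : forall i, ('E_P[eps i] = 0)%E)
    (eps_var : forall i, ('V_P[eps i] < +oo)%E)
    (eta_iid : iid eta)
    (eta_mean : forall i j, ('E_P[fun w => eta i w ord0 j] = 0)%E)
    (eta_var : forall i j, ('V_P[fun w => eta i w ord0 j] < +oo)%E)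
    (eta_posdef : forall i, posdef (covariance_mx P (eta i)))
    (independent : mutual_independence P (tnth [tuple
       sigma_process [set: nat] S;
       sigma_process [set: nat] eps;
       sigma_process [set: nat] eta;
       sigma_process D (fun s w => (g s w, h s w))]))
    (* data *)
    (betastar : 'cV[R]_p)
    (X : nat -> Omega -> 'rV[R]_p)
    (X_def : forall i w, X i w = h (S i w) w + eta i w)
    (Y : nat -> Omega -> R)
    (Y_def : forall i w,
       Y i w = (X i w *m betastar) ord0 ord0 + g (S i w) w + eps i w)
    (* working covariance *)
    (sigma2 phi tau2 : R) (nu : \bar R)
    (sigma2_gt0 : 0 < sigma2) (phi_gt0 : 0 < phi) (tau2_gt0 : 0 < tau2)
    (nu_gt0 : (0 < nu)%E)
    (Sigma : forall n, Omega -> 'M[R]_n)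
    (Sigma_def : forall n w, Sigma n w =
       \matrix_(i < n, j < n) matern sigma2 phi nu (S i w) (S j w) + tau2%:M)
    (* GLS estimator, arbitrary where the normal equations are singular *)
    (betahat : nat -> {RV P >-> 'cV[R]_p})
    (betahat_def : forall n w,
       let Xn := \matrix_(i < n) X i w in
       let Yn := \col_(i < n) Y i w in
       Xn^T *m invmx (Sigma n w) *m Xn \in unitmx ->
       betahat n w = gls (Sigma n w) Xn Yn) :
  cvg_in_probability betahat betastar.
Proof.
have indep3 A B C : sigma_process [set: nat] S A ->
    sigma_process [set: nat] eps B -> sigma_process [set: nat] eta C ->
    P (A `&` B `&` C) = (P A * P B * P C)%E.
  move=> SA eB eC.
  pose i0 : 'I_4 := Ordinal (isT : (0 < 4)%N).
  pose i1 : 'I_4 := Ordinal (isT : (1 < 4)%N).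
  pose i2 : 'I_4 := Ordinal (isT : (2 < 4)%N).
  have u : uniq [:: i0; i1; i2] by [].
  have := independent _ u (tnth [tuple A; B; C; setT]).
  rewrite !big_cons big_nil mule1 muleA => <-.
    congr (P _); apply/seteqP; split => w /=.
      move=> [[Aw Bw] Cw] i; rewrite /= !inE => /or3P[] /eqP ->; by [].
    move=> ABCw; split; [split|].
    - by apply: (ABCw i0); rewrite /= inE.
    - by apply: (ABCw i1); rewrite /= inE.
    - by apply: (ABCw i2); rewrite /= inE.
  by move=> i; rewrite !inE => /or3P[] /eqP ->.
move=> e e0.
have mB n : measurable [set w | e < enorm (betahat n w - betastar)].
  apply: measurable_gt; apply: measurable_enorm_sub => //.
apply: cvg0_prob => // dl dl0.
(* Five exceptional events: the Gram bound, the cross terms, [eps], the [Sigma]-form, and the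
   pathwise smooth terms. The constants [M1] and [M2] depend on [dl], so [kappa] is chosen after
   them. *)
have dl5 : 0 < dl / 5 by rewrite divr_gt0.
have [c c0 gram] := eta_gram_likely eta_iid eta_mean eta_var (eta_posdef 0%N).
have [M1 M1_gt0 eps_l] := eps_likely eps_iid eps_mean eps_var dl5.
have [M2 M2_gt0 Sigma_l] := eta_Sigma_likely eta_iid eta_mean eta_var indep3
  sigma2_gt0 phi_gt0 tau2_gt0 nu_gt0 dl5.
pose M := M1 + M2; have M0 : 0 < M by rewrite addr_gt0.
pose m := c ^+ 2 / (4 * M).
have m0 : 0 < m by rewrite divr_gt0 ?exprn_gt0// mulr_gt0.
pose b := 2 * (1 + p%:R + M / tau2).
have b0 : 0 < b by rewrite mulr_gt0// ltr_wpDr ?ltr_wpDr// divr_ge0// ltW.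
(* The first two bounds are what [gls_error] requires; the third makes its conclusion at most
   [m * e ^+ 2]. *)
pose kappa := Num.min 1 (Num.min (m / 2 / (p%:R + 1)) (m * e ^+ 2 / b)).
have p1 : 0 < p%:R + 1 :> R by rewrite ltr_wpDl.
have kappa0 : 0 < kappa.
  by rewrite !lt_min ltr01/= !divr_gt0// mulr_gt0// exprn_gt0.
have kappa1 : kappa <= 1 by rewrite ge_min lexx.
have kappam : kappa * (p%:R + 1) <= m / 2.
  by rewrite -ler_pdivlMr// !ge_min lexx orbT.
have kappae : kappa * b <= m * e ^+ 2.
  by rewrite -ler_pdivlMr// !ge_min lexx !orbT.
have cross_l := likely_forall (fun j dl' => @cross_likely R d p dO Omega P S eps
  eta eps_iid eps_mean eps_var eta_iid eta_mean eta_var indep3 sigma2 phi tau2 nu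
  sigma2_gt0 phi_gt0 tau2_gt0 nu_gt0 kappa j dl' kappa0) dl5.
have [bad [mbad Pbad good]] := likely_and (likely_and (gram _ dl5) cross_l)
  (likely_and eps_l Sigma_l).
pose B n := [set w | e < enorm (betahat n w - betastar)].
(* On a fixed continuous path the smooth forms are eventually small, and outside [bad n] the
   deterministic bound then contradicts an error larger than [e]. *)
have aeB : {ae P, forall w, \forall n \near \oo, ~ (B n `\` bad n) w}.
  apply: filterS gh_continuous => w cgh.
  have cg : {within D, continuous (fun s => g s w)}.
    exact: (within_continuous_comp cgh (fun=> cvg_fst)).
  have ch j : {within D, continuous (fun s => h s w ord0 j)}.
    have chw : {within D, continuous (fun s => h s w)}.
      exact: (within_continuous_comp cgh (fun=> cvg_snd)).
    apply: (within_continuous_comp (G := fun M : 'rV[R]_p => M ord0 j) chw).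
    exact: coord_continuous.
  have domK := @gauss_dominated_matern R d sigma2 phi nu sigma2_gt0 phi_gt0 nu_gt0.
  have k20 : 0 < kappa ^+ 2 by rewrite exprn_gt0.
  have small (f : 'rV[R]_d -> R) : {within D, continuous f} ->
      \forall n \near \oo, bform
        (invmx (\matrix_(i < n, j < n) matern sigma2 phi nu (S i w) (S j w)
                + tau2%:M))
        (\col_(i < n) f (S i w)) (\col_(i < n) f (S i w)) <= kappa ^+ 2 * n%:R.
    move=> cf; exact: (smooth_form_small domK (matern_sym sigma2 phi nu) D_compact
      cf (fun i => S_in_D i w) tau2_gt0 k20).
  have h_small : \forall n \near \oo, forall j, bform
      (invmx (\matrix_(i < n, j < n) matern sigma2 phi nu (S i w) (S j w)
              + tau2%:M))
      (\col_(i < n) h (S i w) w ord0 j) (\col_(i < n) h (S i w) w ord0 j)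
      <= kappa ^+ 2 * n%:R.
    by apply: filter_forall => j; exact: small (ch j).
  apply: filterS3 (small _ cg) h_small (nbhs_infty_gt 0%N).
  move=> n g_small {}h_small n0 [Bn nbad].
  have N0 : 0 < n%:R :> R by rewrite ltr0n.
  have [[gram_n cross_n] [eps_n Sigma_n]] := good n w nbad.
  pose H := \matrix_(i < n) h (S i w) w.
  pose E := eta_mx eta n w.
  pose K := kernel_mx S sigma2 phi nu n w.
  have psK : psdmx K by exact: kernel_mx_psd.
  have H_small j : bform (invmx (K + tau2%:M)) (col j H) (col j H) <=
      kappa ^+ 2 * n%:R.
    suff -> : col j H = \col_(i < n) h (S i w) w ord0 j by exact: h_small.
    by apply/colP => i; rewrite !mxE.
  have gram' (x : 'cV[R]_p) :
      c * enorm x ^+ 2 * n%:R <= bform 1%:M (E *m x) (E *m x).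
    by rewrite enorm_cV_sqr -sqr_bform1; exact: gram_n.
  have eps' : bform 1%:M (eps_col eps n w) (eps_col eps n w) <= M * n%:R.
    by apply: le_trans (eps_n n0) _; rewrite ler_pM2r// lerDl ltW.
  have Sigma' : \sum_j bform (K + tau2%:M) (col j E) (col j E) <= M * n%:R.
    by apply: le_trans (Sigma_n n0) _; rewrite ler_pM2r// lerDr ltW.
  (* Rules out the event on which [betahat] is arbitrary. *)
  have unit_n := normal_matrix_unit psK tau2_gt0 N0 c0 M0 kappa0 kappa1 kappam
    H_small gram' Sigma'.
  have XE : \matrix_(i < n) X i w = H + E.
    by apply/matrixP => i j; rewrite !mxE X_def mxE.
  have SE : Sigma n w = K + tau2%:M by rewrite Sigma_def.
  have YE : \col_(i < n) Y i w =
      (H + E) *m betastar + \col_(i < n) g (S i w) w + eps_col eps n w.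
    apply/colP => i; rewrite -XE !mxE Y_def; congr (_ + _ + _).
    by rewrite mxE; apply: eq_bigr => j _; rewrite !mxE.
  have := betahat_def n w; rewrite /= XE SE YE => /(_ unit_n) bE.
  have := gls_error psK tau2_gt0 N0 c0 M0 kappa0 kappa1 kappam g_small H_small
    eps' (fun j => cross_n j n0) gram' Sigma' (erefl _ : _ = (H + E) *m betastar +
      \col_(i < n) g (S i w) w + eps_col eps n w).
  rewrite -bE -/m => err.
  have : m * enorm (betahat n w - betastar) ^+ 2 <= m * e ^+ 2.
    apply: le_trans err _; apply: le_trans kappae.
    by rewrite /b [leRHS]mulrCA mulrA.
  rewrite ler_pM2l// ler_pXn2r ?nnegrE ?(ltW e0) ?sqrtr_ge0// leNgt.
  by move: Bn; rewrite /B/= => ->.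
have mBb n : measurable (B n `\` bad n) := measurableD (mB n) (mbad n).
have := likely_ae dl5 mBb aeB.
apply: filterS2 Pbad => n Pb PBb.
apply: (@le_trans _ _ (P (bad n `|` (B n `\` bad n)))).
  apply: le_measure; rewrite ?inE//; first exact: measurableU.
  by move=> w Bw; have [|] := pselect (bad n w); [left|right].
apply: le_trans (measureU2 P (mbad n) (mBb n)) _.
apply: (@le_trans _ _ ((dl / 5 + dl / 5 + (dl / 5 + dl / 5)) + dl / 5)%:E).
  by rewrite EFinD; exact: leeD.
by rewrite lee_fin; lra.
Qed.
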